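(* Let $R$ be a commutative ring, and $\mathcal{C}$ a 1-cotilting class in $\mathrm{Mod}\text{-}R$. Then the following conditions are equivalent: (1) $\mathcal{C}$ is of cofinite type; (2) $\mathcal{C}$ is closed under injective envelopes; (3) for any 1-cotilting module $C$ with $\mathcal{C}={}^\perp C$, we have $E(C)\in\mathrm{Prod}(C)$.
   Context: $\mathrm{Mod}\text{-}R$ is the category of all $R$-modules. ${}^\perp C=\{M\mid \mathrm{Ext}^1_R(M,C)=0\}$. A module $C$ is 1-cotilting if $\mathrm{id}\,C\le1$, $\mathrm{Ext}^1_R(C^X,C)=0$ for every set $X$, and there is an exact sequence $0\to C_1\to C_0\to W\to0$ with $W$ an injective cogenerator and $C_0,C_1$ direct summands of direct products of copies of $C$; the class ${}^\perp C$ is then called a 1-cotilting class. A 1-cotilting class $\mathcal{C}$ is of cofinite type if there is a set $\mathcal{S}$ of finitely presented modules of projective dimension at most $1$ with $\mathcal{C}=\mathcal{S}^\intercal=\{M\mid\mathrm{Tor}_1^R(M,S)=0\ \forall S\in\mathcal{S}\}$. $E(C)$ is the injective envelope of $C$, and $\mathrm{Prod}(C)$ is the class of all modules isomorphic to a direct summand of a product of copies of $C$. *)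

(* Defs.v *)
From HB Require Import structures.
From mathcomp Require Import all_boot all_algebra.
From mathcomp Require Import all_classical.

Set Implicit Arguments.
Unset Strict Implicit.
Unset Printing Implicit Defensive.

Import GRing.Theory.
Import Quotient.

Local Open Scope classical_set_scope.
Local Open Scope ring_scope.
Local Open Scope quotient_scope.

(* Mod-R is [lmodType R]; for R commutative, left, right and two-sided
   R-modules agree.  The zero ring is allowed ([comPzRingType]).

   Sets are the types of the universe of the carriers of modules, so that
   "for every set X" never ranges over proper classes: a power [X -> C] being a
   module bounds this universe from above, and the free module on (the carrier
   of) a module bounds it from below. *)
Definition small_set := Type.

Definition power (R : comPzRingType) (C : lmodType R) (X : small_set) :
  lmodType R := X -> C.

Section Free.
Variables (R : comPzRingType) (X : small_set).

Definition finsupp : {pred X -> R^o} :=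
  fun f => `[< finite_set [set x | f x != 0] >].

Lemma finsupp_submod : GRing.submod_closed finsupp.
Proof.
split=> [|a f g /asboolP ff /asboolP fg]; apply/asboolP.
  by rewrite (_ : [set x | _] = set0) // -subset0 => x /=; rewrite eqxx.
apply: (@sub_finite_set _ _ ([set x | f x != 0] `|` [set x | g x != 0])).
  move=> x /= h; apply: contrapT => /not_orP[].
  move=> /negP/negPn/eqP f0 /negP/negPn/eqP g0; move: h.
  by rewrite /GRing.add/= /GRing.scale/= f0 g0 [a *: 0]scaler0 addr0 eqxx.
by rewrite finite_setU.
Qed.

HB.instance Definition _ :=
  GRing.isSubmodClosed.Build R (X -> R^o) finsupp finsupp_submod.

Record free_mod := FreeMod {
  free_fun :> X -> R^o;
  free_finsupp : free_fun \in finsupp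
}.

HB.instance Definition _ := [isSub for free_fun].
HB.instance Definition _ := [Choice of free_mod by <:].
HB.instance Definition _ := [SubChoice_isSubLmodule of free_mod by <:].

End Free.

Arguments free_mod R X%_type.

Section Basis.
Variables (R : comPzRingType) (X : small_set).

Lemma finsupp_delta (x : X) : (fun y => `[< x = y >]%:R : R^o) \in @finsupp R X.
Proof.
apply/asboolP; apply: (@sub_finite_set _ _ [set x]); last exact: finite_set1.
by move=> y /=; case: asboolP => [->|_] //; rewrite eqxx.
Qed.

Definition basis_elt (x : X) : free_mod R X := FreeMod (finsupp_delta x).

End Basis.

(* M (x) N is the free module on M * N modulo the submodule generated by the
   bilinearity relators. *)
Section Tensor.
Variables (R : comPzRingType) (M N : lmodType R).

Local Notation "<[ m , n ]>" := (basis_elt R (m, n)) (format "<[ m ,  n ]>").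

Inductive bilin_relator : free_mod R (M * N) -> Prop :=
| BilinDl m m' n : bilin_relator (<[m + m', n]> - <[m, n]> - <[m', n]>)
| BilinDr m n n' : bilin_relator (<[m, n + n']> - <[m, n]> - <[m, n']>)
| BilinZl a m n : bilin_relator (<[a *: m, n]> - a *: <[m, n]>)
| BilinZr a m n : bilin_relator (<[m, a *: n]> - a *: <[m, n]>).

Definition bilin_span : {pred free_mod R (M * N)} := fun u =>
  `[< forall U : {pred free_mod R (M * N)}, GRing.submod_closed U ->
      (forall r, bilin_relator r -> r \in U) -> u \in U >].

Lemma bilin_span_submod : GRing.submod_closed bilin_span.
Proof.
split=> [|a u v /asboolP Uu /asboolP Uv]; apply/asboolP => U Usub Urel.
  by case: Usub.
by have [_ UD] := Usub; apply: UD; [exact: Uu|exact: Uv].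
Qed.

HB.instance Definition _ :=
  GRing.isSubmodClosed.Build R (free_mod R (M * N)) bilin_span
    bilin_span_submod.

Definition tensor := quot bilin_span.

HB.instance Definition _ := GRing.Zmodule.on tensor.
HB.instance Definition _ := Quotient.on tensor.

Definition tensor_scale (a : R) (t : tensor) : tensor :=
  \pi_tensor (a *: repr t).

Lemma pi_tensor_scale a (u : free_mod R (M * N)) :
  tensor_scale a (\pi_tensor u) = \pi_tensor (a *: u).
Proof.
apply/eqP; rewrite /tensor_scale -[_ == _]idealrBE -scalerBr rpredZ //.
by rewrite idealrBE reprK.
Qed.

Fact tensor_scaleA a b t :
  tensor_scale a (tensor_scale b t) = tensor_scale (a * b) t.
Proof.
by elim/quotW: t => u; rewrite (pi_tensor_scale b) !pi_tensor_scale scalerA.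
Qed.

Fact tensor_scale1 : left_id 1 tensor_scale.
Proof. by elim/quotW=> u; rewrite pi_tensor_scale scale1r. Qed.

Fact tensor_scaleDr : right_distributive tensor_scale +%R.
Proof.
move=> a; elim/quotW=> u; elim/quotW=> v.
by rewrite -raddfD !pi_tensor_scale -raddfD scalerDr.
Qed.

Fact tensor_scaleDl t : {morph tensor_scale^~ t : a b / a + b}.
Proof.
by move=> a b; elim/quotW: t => u; rewrite !pi_tensor_scale -raddfD scalerDl.
Qed.

HB.instance Definition _ := GRing.Zmodule_isLmodule.Build R tensor
  tensor_scaleA tensor_scale1 tensor_scaleDr tensor_scaleDl.

Lemma pi_tensorZ a (u : free_mod R (M * N)) :
  a *: \pi_tensor u = \pi_tensor (a *: u).
Proof. exact: pi_tensor_scale. Qed.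

Definition tens (m : M) (n : N) : tensor := \pi_tensor <[m, n]>.

End Tensor.

(* The homomorphism of domain M (x) N induced by a bilinear map b. *)
Section TensorLift.
Variables (R : comPzRingType) (M N V : lmodType R) (b : M -> N -> V).

Definition free_lift (u : free_mod R (M * N)) : V :=
  \sum_(p \in [set: (M * N)%type]) u p *: b p.1 p.2.

Definition tensor_lift (t : tensor M N) : V := free_lift (repr t).

Lemma free_liftE (u : free_mod R (M * N)) (D : set (M * N)) :
  [set x | u x != 0] `<=` D ->
  free_lift u = \sum_(p \in D) u p *: b p.1 p.2.
Proof.
move=> uD; apply/esym/fsbig_widen => // p [_ /= nDp].
have [->|up] := eqVneq (u p) 0; first by rewrite scale0r.
by case: nDp; apply: uD.
Qed.

Lemma finite_supp (u : free_mod R (M * N)) : finite_set [set x | u x != 0].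
Proof. by have /asboolP := free_finsupp u. Qed.

Lemma free_lift_is_linear : linear free_lift.
Proof.
move=> a u v; pose D := [set x | u x != 0] `|` [set x | v x != 0].
have finD : finite_set D by rewrite finite_setU; split; exact: finite_supp.
rewrite (@free_liftE (a *: u + v) D); last first.
  move=> p h; have {}h : a * u p + v p != 0 by exact: h.
  apply: contrapT => /not_orP[] /negP/negPn/eqP u0 /negP/negPn/eqP v0.
  by move: h; rewrite u0 v0 mulr0 addr0 eqxx.
rewrite (@free_liftE u D); last by move=> p up; left.
rewrite (@free_liftE v D); last by move=> p vp; right.
rewrite !fsbig_finite // scaler_sumr -big_split; apply: eq_bigr => p _ /=.
by rewrite -[X in X *: _]/(a * u p + v p) scalerDl scalerA.
Qed.

HB.instance Definition _ :=
  GRing.isLinear.Build R (free_mod R (M * N)) V *:%R free_lift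
    free_lift_is_linear.

Lemma free_lift_delta p : free_lift (basis_elt R p) = b p.1 p.2.
Proof.
rewrite (@free_liftE _ [set p]) => [|q /=]; last first.
  by case: asboolP => [->|_] //; rewrite eqxx.
by rewrite fsbig_set1 /=; case: asboolP => // _; rewrite scale1r.
Qed.

Hypotheses (bl : forall m, linear (b m)) (br : forall n, linear (b^~ n)).

Lemma free_lift_span u : u \in @bilin_span R M N -> free_lift u = 0.
Proof.
pose ker : {pred free_mod R (M * N)} := [pred u | free_lift u == 0].
move=> /asboolP /(_ ker) keru; apply/eqP; apply: keru => [|r].
  split=> [|a v w]; rewrite !inE ?raddf0 // => /eqP v0 /eqP w0.
  by rewrite linearP /= v0 w0 scaler0 addr0.
have bD m n n' : b m (n + n') = b m n + b m n'.
  by have := bl m 1 n n'; rewrite !scale1r.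
have bD' m m' n : b (m + m') n = b m n + b m' n.
  by have := br n 1 m m'; rewrite !scale1r.
have b0 m : b m 0 = 0 by apply: (addrI (b m 0)); rewrite -bD !addr0.
have b0' n : b 0 n = 0 by apply: (addrI (b 0 n)); rewrite -bD' !addr0.
have liftZ c v : free_lift (c *: v) = c *: free_lift v by exact: linearZ_LR.
case=> [m m' n|m n n'|a m n|a m n]; rewrite !inE !raddfB /=.
- by rewrite !free_lift_delta /= bD' -addrA -opprD subrr.
- by rewrite !free_lift_delta /= bD -addrA -opprD subrr.
- by rewrite liftZ !free_lift_delta /= -[a *: m]addr0 (br n) b0' addr0 subrr.
- by rewrite liftZ !free_lift_delta /= -[a *: n]addr0 (bl m) b0 addr0 subrr.
Qed.

Lemma tensor_lift_pi (u : free_mod R (M * N)) :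
  tensor_lift (\pi_(tensor M N) u) = free_lift u.
Proof.
apply/eqP; rewrite -subr_eq0 -raddfB; apply/eqP/free_lift_span.
by rewrite idealrBE reprK.
Qed.

Lemma tensor_lift_is_linear : linear tensor_lift.
Proof.
move=> a; elim/quotW=> u; elim/quotW=> v.
have -> : a *: \pi_(tensor M N) u + \pi_(tensor M N) v
    = \pi_(tensor M N) (a *: u + v).
  by rewrite raddfD pi_tensorZ.
by rewrite !tensor_lift_pi linearP.
Qed.

Lemma tensor_liftE m n : tensor_lift (tens m n) = b m n.
Proof. by rewrite tensor_lift_pi free_lift_delta. Qed.

End TensorLift.

Section TensorBilinear.
Variables (R : comPzRingType) (M N : lmodType R).

Let pi_eq (u v : free_mod R (M * N)) :
  bilin_relator (u - v) -> \pi_(tensor M N) u = \pi_(tensor M N) v.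
Proof.
move=> uv; apply/eqP; rewrite -[_ == _]idealrBE.
by apply/asboolP => U _; apply.
Qed.

Lemma tens_linearr (m : M) : linear (@tens R M N m).
Proof.
move=> a n n'.
rewrite /tens.
transitivity (\pi_(tensor M N) (basis_elt R (m, a *: n) + basis_elt R (m, n'))).
  by apply: pi_eq; rewrite opprD addrA; exact: BilinDr.
rewrite raddfD; congr (_ + _).
rewrite pi_tensorZ; apply: pi_eq; exact: BilinZr.
Qed.

Lemma tens_linearl (n : N) : linear (fun m : M => tens m n).
Proof.
move=> a m m'.
rewrite /tens.
transitivity (\pi_(tensor M N) (basis_elt R (a *: m, n) + basis_elt R (m', n))).
  by apply: pi_eq; rewrite opprD addrA; exact: BilinDl.
rewrite raddfD; congr (_ + _).
rewrite pi_tensorZ; apply: pi_eq; exact: BilinZl.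
Qed.

End TensorBilinear.

(* M (x) f *)
Section TensorMap.
Variables (R : comPzRingType) (M N N' : lmodType R) (f : {linear N -> N'}).

Definition tensor_map : tensor M N -> tensor M N' :=
  tensor_lift (fun m n => tens m (f n)).

Let bl (m : M) : linear (fun n => tens m (f n)).
Proof. by move=> a n n'; rewrite linearP tens_linearr. Qed.

Let br (n : N) : linear (fun m : M => tens m (f n)).
Proof. exact: tens_linearl. Qed.

HB.instance Definition _ := GRing.isLinear.Build R (tensor M N) (tensor M N')
  *:%R tensor_map (tensor_lift_is_linear bl br).

Lemma tensor_mapE m n : tensor_map (tens m n) = tens m (f n).
Proof. exact: tensor_liftE bl br m n. Qed.

End TensorMap.

Arguments tensor_map {R} M {N N'} f.

Section Homological.
Variable R : comPzRingType.
Implicit Types (M N C E I P S W : lmodType R) (X : small_set).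

Definition exact_at M N P (f : {linear M -> N}) (g : {linear N -> P}) :=
  range f = g @^-1` [set 0].

Definition surjective_map M N (f : {linear M -> N}) := range f = setT.

Definition short_exact M N P (f : {linear M -> N}) (g : {linear N -> P}) :=
  [/\ injective f, exact_at f g & surjective_map g].

Definition injective_module I :=
  forall M N (i : {linear M -> N}) (f : {linear M -> I}), injective i ->
  exists g : {linear N -> I}, forall x, g (i x) = f x.

Definition projective_module P :=
  forall M N (p : {linear M -> N}) (f : {linear P -> N}), surjective_map p ->
  exists g : {linear P -> M}, forall x, p (g x) = f x.

Record projective_resolution M := ProjectiveResolution {
  res_mod :> nat -> lmodType R;
  res_d : forall n, {linear res_mod n.+1 -> res_mod n};
  res_aug : {linear res_mod 0%N -> M};
  res_projective : forall n, projective_module (res_mod n);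
  res_aug_surj : surjective_map res_aug;
  res_exact0 : exact_at (res_d 0) res_aug;
  res_exactS : forall n, exact_at (res_d n.+1) (res_d n)
}.

(* Ext^1(M, C) is the cohomology at Hom(P_1, C) of the complex Hom(P, C) and
   Tor_1(M, S) is the homology at M (x) P_1 of the complex M (x) P, where P is
   any projective resolution of M and of S respectively. *)
Definition Ext1_zero M C :=
  forall (P : projective_resolution M) (f : {linear P 1%N -> C}),
  (forall x, f (res_d P 1 x) = 0) ->
  exists g : {linear P 0%N -> C}, forall x, f x = g (res_d P 0 x).

Definition Tor1_zero M S :=
  forall P : projective_resolution S,
  exact_at (tensor_map M (res_d P 1)) (tensor_map M (res_d P 0)).

Definition projdim_le1 M :=
  exists (P1 P0 : lmodType R) (f : {linear P1 -> P0}) (g : {linear P0 -> M}),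
  [/\ projective_module P1, projective_module P0 & short_exact f g].

Definition injdim_le1 M :=
  exists (I0 I1 : lmodType R) (f : {linear M -> I0}) (g : {linear I0 -> I1}),
  [/\ injective_module I0, injective_module I1 & short_exact f g].

Definition finitely_presented M :=
  exists (m n : nat) (f : {linear 'rV[R]_m -> 'rV[R]_n})
    (g : {linear 'rV[R]_n -> M}), exact_at f g /\ surjective_map g.

Definition cogenerator W :=
  forall M, exists X (i : {linear M -> power W X}), injective i.

Definition Prod C M :=
  exists X N (phi : {linear (M * N)%type -> power C X}), bijective phi.

Definition injective_envelope C E :=
  injective_module E /\
  exists i : {linear C -> E}, injective i /\
    forall U : set E, GRing.submod_closed [in U] ->
    U `&` range i `<=` [set 0] -> U `<=` [set 0].

Definition left_perp C : lmodType R -> Prop := fun M => Ext1_zero M C.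

Definition one_cotilting C :=
  [/\ injdim_le1 C, forall X, Ext1_zero (power C X) C
    & exists (C1 C0 W : lmodType R) (f : {linear C1 -> C0})
        (g : {linear C0 -> W}),
      [/\ Prod C C1, Prod C C0, injective_module W, cogenerator W
        & short_exact f g]].

Definition one_cotilting_class (K : lmodType R -> Prop) :=
  exists2 C, one_cotilting C & forall M, K M <-> left_perp C M.

Definition cofinite_type (K : lmodType R -> Prop) :=
  exists (J : small_set) (S : J -> lmodType R),
  (forall j, finitely_presented (S j) /\ projdim_le1 (S j)) /\
  (forall M, K M <-> forall j, Tor1_zero M (S j)).

Definition closed_injective_envelopes (K : lmodType R -> Prop) :=
  forall M E, K M -> injective_envelope M E -> K E.

End Homological.

(* Main.v *)
(* Let K be the class of modules M with Ext^1(M, C) = 0. It consists of the modules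
   M cogenerated by C: K contains the powers of C and, as id C <= 1, is closed
   under submodules; conversely the maps from M in K to the cogenerator W lift
   along C_0 -> W.

   (2) <=> (3): an injective module cogenerated by C is a summand of a power of C.

   (1) => (2): for S finitely presented of projective dimension at most 1, the
   vanishing of Tor_1(M, S) says that a finite linear system over R has no nonzero
   solution in M. By McCoy's theorem this only depends on the elements of M killed
   by a certain ideal, so it passes to essential extensions.

   (2) => (1): K is cogenerated by the injective module E = E(C), so M lies in K
   iff for every nonzero x in M some nonzero e in E is killed by ann(x). When no
   nonzero element of E is killed by the finite set s = (s_1, ..., s_n), the
   cokernel of s : R -> R^n tests through Tor_1 that no nonzero element of M is
   killed by s. It remains to see that, if every finite subset of J kills a nonzero
   element of E, so does J. By transfinite induction J is a well-ordered union of
   sets J_i with this property. Let L be the union of the annihilators of the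
   elements of E killed by J_i; it suffices that Ext^1(R / L, C) = 0. In a tree
   whose branches record all maps to C from the bounded families of elements of E
   indexed by the nodes, spread a copy of R / L modulo bounded families along each
   branch. Since K contains the submodules of powers of E, a map L -> C that does
   not extend to R would produce a map on bounded families which differs from the
   one recorded by any branch: this is Bazzoni's cardinality argument for the
   pure-injectivity of cotilting modules, run as a diagonal argument. *)
Require Import Defs.
From HB Require Import structures.
From mathcomp Require Import all_boot all_algebra.
From mathcomp Require Import finmap all_classical.

Set Implicit Arguments.
Unset Strict Implicit.
Unset Printing Implicit Defensive.

Import GRing.Theory.
Import Quotient.

Local Open Scope classical_set_scope.
Local Open Scope ring_scope.
Local Open Scope quotient_scope.

(** * Submodules and quotient modules *)

Section LinearMaps.
Variable R : comPzRingType.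
Implicit Types A B C D E I J M N P Q S V W : lmodType R.

Definition Lin A B (f : A -> B) (lf : linear f) : {linear A -> B} :=
  HB.pack f (GRing.isLinear.Build R A B *:%R f lf).

(** A linear map out of [Q] may be defined on any module surjecting onto [Q]: for a section [s] of
    [u], the values of [v \o s] do not depend on the chosen preimages, and linearity follows. *)
Lemma descend D Q C (u : {linear D -> Q}) (v : {linear D -> C}) :
  (forall q, exists d, u d = q) -> (forall d, u d = 0 -> v d = 0) ->
  exists g : {linear Q -> C}, forall d, g (u d) = v d.
Proof.
move=> /choice[s us] uv.
have vs d : v (s (u d)) = v d.
  by apply/eqP; rewrite -subr_eq0 -linearB uv // linearB us subrr.
have lg : linear (v \o s).
  by move=> a x y /=; rewrite -linearP -[RHS]vs linearP !us.
by exists (Lin lg) => d; exact: vs.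
Qed.

Section SubModule.
Variables (V : lmodType R) (U : set V).

Definition sub_pred (closedU : GRing.submod_closed [in U]) : {pred V} := [in U].

Variable closedU : GRing.submod_closed [in U].

HB.instance Definition _ :=
  GRing.isSubmodClosed.Build R V (sub_pred closedU) closedU.

Record submod := SubMod {
  submod_val :> V;
  submod_valP : submod_val \in sub_pred closedU
}.

HB.instance Definition _ := [isSub for submod_val].
HB.instance Definition _ := [Choice of submod by <:].
HB.instance Definition _ := [SubChoice_isSubLmodule of submod by <:].

Lemma submod_val_linear : linear submod_val.
Proof. by []. Qed.

Definition subincl : {linear submod -> V} := Lin submod_val_linear.

Lemma subincl_inj : injective subincl.
Proof. exact: val_inj. Qed.

Lemma subinclP (x : submod) : U (subincl x).
Proof. exact: set_mem (submod_valP x). Qed.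

Lemma subincl_surj x : U x -> exists y : submod, subincl y = x.
Proof. by move=> /mem_set Ux; exists (@SubMod x Ux). Qed.

End SubModule.

Section QuotientModule.
Variables (V : lmodType R) (U : set V) (closedU : GRing.submod_closed [in U]).

Definition quotmod := quot (sub_pred closedU).

HB.instance Definition _ := GRing.Zmodule.on quotmod.
HB.instance Definition _ := Quotient.on quotmod.

Definition quotmod_scale (a : R) (x : quotmod) : quotmod :=
  \pi_quotmod (a *: repr x).

Lemma pi_quotmod_scale a (x : V) :
  quotmod_scale a (\pi_quotmod x) = \pi_quotmod (a *: x).
Proof.
apply/eqP; rewrite /quotmod_scale -[_ == _]idealrBE -scalerBr rpredZ //.
by rewrite idealrBE reprK.
Qed.

Fact quotmod_scaleA a b x :
  quotmod_scale a (quotmod_scale b x) = quotmod_scale (a * b) x.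
Proof.
by elim/quotW: x => x; rewrite (pi_quotmod_scale b) !pi_quotmod_scale scalerA.
Qed.

Fact quotmod_scale1 : left_id 1 quotmod_scale.
Proof. by elim/quotW=> x; rewrite pi_quotmod_scale scale1r. Qed.

Fact quotmod_scaleDr : right_distributive quotmod_scale +%R.
Proof.
move=> a; elim/quotW=> x; elim/quotW=> y.
by rewrite -raddfD !pi_quotmod_scale -raddfD scalerDr.
Qed.

Fact quotmod_scaleDl x : {morph quotmod_scale^~ x : a b / a + b}.
Proof.
by move=> a b; elim/quotW: x => x; rewrite !pi_quotmod_scale -raddfD scalerDl.
Qed.

HB.instance Definition _ := GRing.Zmodule_isLmodule.Build R quotmod
  quotmod_scaleA quotmod_scale1 quotmod_scaleDr quotmod_scaleDl.

Lemma quot_map_linear : linear (\pi_quotmod : V -> quotmod).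
Proof.
by move=> a x y; rewrite raddfD; congr (_ + _); exact/esym/pi_quotmod_scale.
Qed.

Definition quot_map : {linear V -> quotmod} := Lin quot_map_linear.

Lemma quot_map_surj x : exists y, quot_map y = x.
Proof. by elim/quotW: x => x; exists x. Qed.

Lemma quot_map_eq0 x : quot_map x = 0 <-> U x.
Proof.
have -> : U x <-> x \in sub_pred closedU by split=> [/mem_set|/set_mem].
rewrite -[x in x \in _]subr0 idealrBE; split=> [x0|/eqP x0].
  by apply/eqP; exact: etrans x0 (esym (raddf0 quot_map)).
exact: etrans x0 (raddf0 quot_map).
Qed.

End QuotientModule.

End LinearMaps.

(** * Injectivity, projectivity and free modules *)

Section Homs.
Variable R : comPzRingType.
Implicit Types A B C D E I J M N P Q S V W : lmodType R.

Lemma surjP A B (f : {linear A -> B}) :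
  surjective_map f <-> forall y, exists x, f x = y.
Proof.
split=> [fT y|fT]; last first.
  by apply/seteqP; split=> // y _; have [x <-] := fT y; exists x.
by have [x _ <-] : range f y by [rewrite fT]; exists x.
Qed.

Lemma exactP A B C (f : {linear A -> B}) (g : {linear B -> C}) :
  exact_at f g <-> forall y, g y = 0 <-> exists x, f x = y.
Proof.
split=> [fg y|fg].
  rewrite -[g y = 0]/((g @^-1` [set 0]) y) -fg.
  by split=> [[x _ <-]|[x <-]]; exists x.
apply/seteqP; split=> y /=; last by case/fg => x <-; exists x.
by case=> x _ <-; apply/fg; exists x.
Qed.

Lemma exact0 A B C (f : {linear A -> B}) (g : {linear B -> C}) x :
  exact_at f g -> g (f x) = 0.
Proof. by move=> /exactP fg; apply/fg; exists x. Qed.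

Lemma lin_inj A B (f : {linear A -> B}) :
  (forall x, f x = 0 -> x = 0) -> injective f.
Proof.
move=> f0 x y fxy; apply/eqP; rewrite -subr_eq0; apply/eqP/f0.
by rewrite linearB fxy subrr.
Qed.

Lemma inj_eq0 A B (f : {linear A -> B}) x : injective f -> f x = 0 -> x = 0.
Proof. by move=> fi fx; apply: fi; rewrite fx linear0. Qed.

Fact elt_linear A (x : A) : linear (fun r : R^o => r *: x).
Proof. by move=> a r s; rewrite scalerDl scalerA. Qed.

Definition elt A (x : A) : {linear R^o -> A} := Lin (elt_linear x).

Fact range_submod A B (f : {linear A -> B}) : GRing.submod_closed [in range f].
Proof.
split=> [|a x y]; first by apply/mem_set; exists 0 => //; rewrite linear0.
move=> /set_mem[u _ <-] /set_mem[v _ <-]; apply/mem_set.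
by exists (a *: u + v) => //; rewrite linearP.
Qed.

Fact ker_submod A B (f : {linear A -> B}) :
  GRing.submod_closed [in [set x | f x = 0]].
Proof.
split=> [|a x y]; first by apply/mem_set; exact: linear0.
move=> /set_mem/= fx /set_mem/= fy; apply/mem_set => /=.
by rewrite linearP fx fy scaler0 addr0.
Qed.

Lemma ker_mem A B (f : {linear A -> B}) x : f x = 0 ->
  exists y, subincl (ker_submod f) y = x.
Proof. by move=> fx; exact: subincl_surj. Qed.

Lemma lift_inj A B C (f : {linear B -> C}) (h : {linear A -> C}) :
  injective f -> (forall x, exists y, f y = h x) ->
  exists g : {linear A -> B}, forall x, f (g x) = h x.
Proof.
move=> fi /choice[g fg].
have lg : linear g by move=> a x y; apply: fi; rewrite linearP !fg linearP.
by exists (Lin lg).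
Qed.

(** As [i] need not be injective, [f] is first pushed down to the range of [i] and extended from
    there. *)
Lemma inj_ext I N Q (i : {linear N -> Q}) (f : {linear N -> I}) :
  injective_module I -> (forall n, i n = 0 -> f n = 0) ->
  exists g : {linear Q -> I}, forall n, g (i n) = f n.
Proof.
move=> injI kif; pose U : lmodType R := submod (range_submod i).
have [u iu] : exists u : {linear N -> U}, forall n,
  subincl (range_submod i) (u n) = i n.
  apply: lift_inj; first exact: subincl_inj.
  by move=> n; apply: subincl_surj; exists n.
have [f' f'u] : exists f' : {linear U -> I}, forall n, f' (u n) = f n.
  apply: descend => [q|n un0]; last by apply: kif; rewrite -iu un0 linear0.
  have [n _ nq] := subinclP q; exists n; apply: (@subincl_inj _ _ _
    (range_submod i)).
  by rewrite iu.
have [g gu] := injI _ _ (subincl (range_submod i)) f' (@subincl_inj _ _ _ _).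
by exists g => n; rewrite -iu gu f'u.
Qed.

(** As [d] need not be surjective, projectivity is applied to the pullback of [h] and [d], which
    does surject onto [P]; a section of it has the lift as second component. *)
Lemma proj_lift P A B (d : {linear A -> B}) (h : {linear P -> B}) :
  projective_module P -> (forall x, exists y, d y = h x) ->
  exists g : {linear P -> A}, forall x, d (g x) = h x.
Proof.
move=> projP dh; pose k : {linear (P * A)%type -> B} := (h \o fst) \- (d \o
  snd).
pose p : {linear submod (ker_submod k) -> P} := fst \o subincl (ker_submod k).
have [|s ps] := projP _ _ p idfun.
  apply/surjP => x; have [y yx] := dh x.
  have [|z xy] := @subincl_surj _ _ _ (ker_submod k) (x, y).
    by rewrite /= yx subrr.
  by exists z; rewrite /= /p /= -[submod_val z]/(subincl _ z) xy.
exists (snd \o subincl _ \o s) => x; apply/esym/eqP; rewrite -subr_eq0;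
  apply/eqP.
by have := subinclP (s x); have /= -> := ps x.
Qed.

Lemma injective_retract I J (r : {linear I -> J}) (s : {linear J -> I}) :
  cancel s r -> injective_module I -> injective_module J.
Proof.
move=> sK injI M N i f ii.
have [g gi] := injI _ _ i (s \o f) ii.
by exists (r \o g) => x /=; rewrite gi /= sK.
Qed.

Lemma projective_retract P Q (r : {linear P -> Q}) (s : {linear Q -> P}) :
  cancel s r -> projective_module P -> projective_module Q.
Proof.
move=> sK projP M N p f ps.
have [g pg] := projP _ _ p (f \o r) ps.
by exists (g \o s) => x /=; rewrite pg /= sK.
Qed.

Lemma injective_power I X : injective_module I -> injective_module (power I X).
Proof.
move=> injI M N i f ii.
have lf x : linear (fun m => f m x) by move=> a m n; rewrite linearP.
have /choice[g gi] x :
    exists g : {linear N -> I}, forall m, g (i m) = Lin (lf x) m.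
  exact: injI.
have lg : linear (fun n x => g x n : I).
  by move=> a m n; apply/funext => x; rewrite linearP.
by exists (@Lin _ _ (power I X) _ lg) => m; apply/funext => x; rewrite /= gi.
Qed.

Section FreeModule.
Variable X : small_set.
Local Notation F := (free_mod R X).

Lemma free_supp_finite (u : F) : finite_set [set x | u x != 0].
Proof. by have /asboolP := free_finsupp u. Qed.

Variables (V : lmodType R) (b : X -> V).

(** [X] is a bare type; [{classic X}] equips it with the choice structure that finitely supported
    sums require. *)
Definition free_map (u : F) : V := \sum_(x \in [set: {classic X}]) u x *: b x.

Lemma free_mapE (u : F) (D : set X) : [set x | u x != 0] `<=` D ->
  free_map u = \sum_(x \in (D : set {classic X})) u x *: b x.
Proof.
move=> uD; apply/esym/fsbig_widen => // p [_ /= nDp].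
have [->|up] := eqVneq (u p) 0; first by rewrite scale0r.
by case: nDp; apply: uD.
Qed.

Lemma free_map_linear : linear free_map.
Proof.
move=> a u v; pose D := [set x | u x != 0] `|` [set x | v x != 0].
have finD : finite_set D by rewrite finite_setU; split; exact: free_supp_finite.
rewrite (@free_mapE (a *: u + v) D); last first.
  move=> p h; have {}h : a * u p + v p != 0 by exact: h.
  apply: contrapT => /not_orP[] /negP/negPn/eqP u0 /negP/negPn/eqP v0.
  by move: h; rewrite u0 v0 mulr0 addr0 eqxx.
rewrite (@free_mapE u D); last by move=> p up; left.
rewrite (@free_mapE v D); last by move=> p vp; right.
rewrite !fsbig_finite // scaler_sumr -big_split; apply: eq_bigr => p _ /=.
by rewrite -[X in X *: _]/(a * u p + v p) scalerDl scalerA.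
Qed.

Lemma free_map_delta x : Lin free_map_linear (basis_elt R x) = b x.
Proof.
rewrite /= (@free_mapE _ [set x]) => [|q /=]; last first.
  by case: asboolP => [->|_] //; rewrite eqxx.
by rewrite fsbig_set1 /=; case: asboolP => // _; rewrite scale1r.
Qed.

End FreeModule.

Lemma free_lift_ex X V (b : X -> V) :
  exists g : {linear free_mod R X -> V}, forall x, g (basis_elt R x) = b x.
Proof. by exists (Lin (free_map_linear b)) => x; exact: free_map_delta. Qed.

Fact free_coord_linear X (x : X) : linear (fun u : free_mod R X => u x : R^o).
Proof. by []. Qed.

Definition free_coord X (x : X) : {linear free_mod R X -> R^o} :=
  Lin (free_coord_linear x).

Lemma free_eq X (u v : free_mod R X) : (forall x, u x = v x) -> u = v.
Proof. by move=> uv; apply: val_inj; apply/funext. Qed.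

Lemma free_decomp X (u : free_mod R X) (D : set X) : finite_set D ->
  [set x | u x != 0] `<=` D ->
  u = \sum_(x <- fset_set (D : set {classic X})) (u x : R) *: @basis_elt R X x.
Proof.
move=> finD uD; apply: free_eq => y.
rewrite -[RHS]/(free_coord y _) linear_sum /=.
have [Dy|nDy] := pselect (D y); last first.
  have -> : u y = 0 by apply: contrapT => /eqP uy; apply: nDy; exact: uD.
  rewrite big1_seq // => x /andP[_]; rewrite in_fset_set // inE => Dx.
  rewrite -[LHS]/(u x * (basis_elt R x) y) /=.
  by case: asboolP => [xy|]; rewrite ?mulr0 //; case: nDy; rewrite -xy.
have yD : (y : {classic X}) \in fset_set (D : set {classic X}).
  by rewrite in_fset_set // inE.
rewrite (big_rem _ yD) /= big1_seq => [|x].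
  rewrite addr0 -[RHS]/(u y * (basis_elt R y) y) /=.
  by case: asboolP => // _; rewrite mulr1.
rewrite mem_rem_uniq ?fset_uniq // => /andP[_ /andP[/= /eqP xy _]].
rewrite -[LHS]/(u x * (basis_elt R x) y) /=.
by case: asboolP => [//|_]; rewrite mulr0.
Qed.

Lemma free_lin_eq X V (f g : {linear free_mod R X -> V}) :
  (forall x, f (basis_elt R x) = g (basis_elt R x)) -> f =1 g.
Proof.
move=> fg u; rewrite (@free_decomp _ u _ (free_supp_finite u)) //.
by rewrite !linear_sum; apply: eq_bigr => x _; rewrite !linearZ_LR fg.
Qed.

Lemma free_projective X : projective_module (free_mod R X).
Proof.
move=> M N p f /surjP ps.
have /choice[b pb] x : exists m, p m = f (basis_elt R x) by exact: ps.
have [g gb] := free_lift_ex b; exists g.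
by apply: (@free_lin_eq _ _ (p \o g)) => x /=; rewrite gb pb.
Qed.

Lemma rV_projective n : projective_module 'rV[R]_n.
Proof.
move=> M N p f /surjP ps.
have /choice[b pb] k : exists m, p m = f (delta_mx 0 k) by exact: ps.
have lg : linear (fun v : 'rV[R]_n => \sum_k v 0 k *: b k).
  move=> a u v; rewrite scaler_sumr -big_split; apply: eq_bigr => k _ /=.
  by rewrite !mxE scalerDl scalerA.
exists (Lin lg) => v /=; rewrite [v in RHS]row_sum_delta !linear_sum.
by apply: eq_bigr => k _; rewrite !linearZ_LR pb.
Qed.

Lemma regular_projective : projective_module R^o.
Proof.
apply: (@projective_retract 'rV[R]_1 R^o (Lin (_ : linear (fun v : 'rV[R]_1 =>
  v 0 0 : R^o)))
   (Lin (_ : linear (fun r : R^o => const_mx r : 'rV[R]_1)))).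
- by move=> a u v; rewrite !mxE.
- by move=> a r s; apply/matrixP => i j; rewrite !mxE.
- by move=> lr ls r; rewrite /= mxE.
- exact: rV_projective.
Qed.

End Homs.

(** * Vanishing of Ext *)

Section Ext.
Variable R : comPzRingType.
Implicit Types A B C D E I J M N P Q S V W : lmodType R.

(** Bundling a map with its source and target turns one step of a free resolution into an endomap of
    a single type, which [iter] can repeat. *)
Record arrow := Arrow {
  src : lmodType R; tgt : lmodType R; arr : {linear src -> tgt}
}.

Definition free_cover M : {linear free_mod R M -> M} :=
  Lin (free_map_linear (@id M)).

Lemma free_cover_surj M : surjective_map (free_cover M).
Proof. by apply/surjP => x; exists (basis_elt R x); exact: free_map_delta. Qed.

Definition next_arrow (a : arrow) : arrow :=
  Arrow (subincl (ker_submod (arr a)) \o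
         free_cover (submod (ker_submod (arr a)))).

Lemma next_arrow_exact (a : arrow) :
  @exact_at R _ _ _ (arr (next_arrow a)) (arr a).
Proof.
apply/exactP => y; split=> [/ker_mem[z <-]|[x <-]].
  have /surjP/(_ z)[x <-] := @free_cover_surj (submod (ker_submod (arr a))).
  by exists x.
exact: (subinclP (free_cover _ x)).
Qed.

Definition free_arrow M n := iter n next_arrow (Arrow (free_cover M)).

Definition free_resolution M : projective_resolution M.
Proof.
apply: (@ProjectiveResolution R M (fun n => src (free_arrow M n))
  (fun n => arr (free_arrow M n.+1)) (arr (free_arrow M 0))).
- by case=> [|n]; exact: free_projective.
- exact: free_cover_surj.
- exact: next_arrow_exact.
- by move=> n; exact: next_arrow_exact.
Defined.

(* Ext^1(M, C) = 0, with N -> Q not assumed injective so that extensions can be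
   tested without forming image modules. *)
Definition ext_lift M C :=
  forall N Q (i : {linear N -> Q}) (p : {linear Q -> M}),
  exact_at i p -> surjective_map p ->
  forall f : {linear N -> C}, (forall n, i n = 0 -> f n = 0) ->
  exists g : {linear Q -> C}, forall n, g (i n) = f n.

(** Lift [p0] to [a : P0 -> Q]. Then [a \o d] lands in the image of [i], and [f] transports along it
    to a map [phi] on [P1], which extends to [g] on [P0]. Since [Q] is the quotient of [N * P0]
    under [i] and [a], the maps [f] and [g] glue to a map on [Q]. *)
Lemma ext_lift_cover M C P1 P0 (d : {linear P1 -> P0}) (p0 : {linear P0 -> M}) :
  projective_module P0 -> exact_at d p0 -> surjective_map p0 ->
  (forall f : {linear P1 -> C}, (forall y, d y = 0 -> f y = 0) ->
    exists g : {linear P0 -> C}, forall y, g (d y) = f y) ->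
  ext_lift M C.
Proof.
move=> projP0 dp0 p0s extd N Q i p ip ps f kif.
have [a pa] : exists a : {linear P0 -> Q}, forall x, p (a x) = p0 x.
  by apply: projP0; exact: ps.
pose k : {linear (P1 * N)%type -> Q} := (a \o d \o fst) \- (i \o snd).
pose D := submod (ker_submod k).
have kD (z : D) : a (d (val z).1) = i (val z).2.
  by apply/eqP; rewrite -subr_eq0; apply/eqP; exact: subinclP z.
have Dk y n : a (d y) = i n -> exists z : D, val z = (y, n).
  move=> yn; have [|z] := @ker_mem _ _ _ k (y, n).
    by rewrite /= yn subrr.
  by exists z.
have [phi phiE] : exists phi : {linear P1 -> C}, forall z : D,
    phi ((fst \o subincl (ker_submod k)) z) = (f \o snd \o subincl _) z.
  apply: descend => [y|z /= z0].
    have /exactP/(_ (a (d y)))[] := ip.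
    rewrite pa (exact0 _ dp0) => /(_ erefl)[n yn] _.
    by have [|z zE] := Dk y n; [|exists z; rewrite /= zE].
  by apply: kif; rewrite -kD z0 !linear0.
have {}phiE y n : a (d y) = i n -> phi y = f n.
  by move=> /Dk[z zE]; have := phiE z; rewrite /= zE.
have [|g gd] := extd phi.
  by move=> y dy; rewrite (phiE y 0) ?linear0 // dy !linear0.
pose u : {linear (N * P0)%type -> Q} := (i \o fst) \+ (a \o snd).
pose v : {linear (N * P0)%type -> C} := (f \o fst) \+ (g \o snd).
have [q|[n x] /= ux|h hu] := @descend _ _ _ _ u v.
- have /surjP/(_ (p q))[x xq] := p0s.
  have /exactP/(_ (q - a x))[] := ip.
  rewrite linearB pa xq subrr => /(_ erefl)[n nq] _.
  by exists (n, x); rewrite /= nq subrK.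
- have p0x : p0 x = 0.
    by have := congr1 p ux; rewrite linearD (exact0 _ ip) add0r pa linear0.
  have /exactP/(_ x)[/(_ p0x)[y yx] _] := dp0.
  have ay : a (d y) = i (- n).
    by apply/eqP; rewrite linearN -addr_eq0 addrC yx; exact/eqP.
  by rewrite -yx gd (phiE y _ ay) linearN subrr.
- by exists h => n; have := hu (n, 0); rewrite /= !linear0 !addr0.
Qed.

(** Testing one resolution, the free one, yields [ext_lift]. Conversely [ext_lift] is applied to the
    start of any resolution, where the cocycles are the maps vanishing on the kernel of
    [res_d P 0]. *)
Lemma Ext1_zeroE M C : Ext1_zero M C <-> ext_lift M C.
Proof.
split=> [ext|ext P f fd].
  have P := free_resolution M.
  apply: (@ext_lift_cover M C _ _ _ _ (@res_projective _ _ P 0%N)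
    (res_exact0 P) (res_aug_surj P)) => f fd.
  have [|g fg] := ext P f.
    by move=> x; apply: fd; exact: exact0 (res_exactS P 0).
  by exists g => y; rewrite fg.
have [|g gf] := ext _ _ _ _ (res_exact0 P) (res_aug_surj P) f.
  by move=> y dy; have /exactP/(_ y)[/(_ dy)[x <-]] := res_exactS P 0.
by exists g.
Qed.

(** The pullback [Q] of [h] and [g] is an extension of [M] by [A]. It has a retraction [r] onto [A],
    and the second projection minus [f \o r] descends to [M]. *)
Lemma ext_lift_hom M A B D (f : {linear A -> B}) (g : {linear B -> D}) :
  ext_lift M A -> short_exact f g ->
  forall h : {linear M -> D}, exists h' : {linear M -> B},
    forall x, g (h' x) = h x.
Proof.
move=> ext [fi fg /surjP gs] h.
pose k : {linear (M * B)%type -> D} := (h \o fst) \- (g \o snd).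
pose Q : lmodType R := submod (ker_submod k).
have kQ (z : Q) : h (val z).1 = g (val z).2.
  by apply/eqP; rewrite -subr_eq0; apply/eqP; exact: subinclP z.
have Qk y n : h y = g n -> exists z : Q, val z = (y, n).
  move=> yn; have [|z] := @ker_mem _ _ _ k (y, n).
    by rewrite /= yn subrr.
  by exists z.
have [i iE] : exists i : {linear A -> Q}, forall a, val (i a) = (0, f a).
  have lj : linear (fun a : A => (0 : M, f a)).
    move=> r a b; rewrite linearP.
    by congr (_, _); rewrite -[RHS]/(r *: 0 + 0) scaler0 addr0.
  have [|a|i iE] := @lift_inj _ _ _ _ (subincl (ker_submod k)) (Lin lj).
  - exact: subincl_inj.
  - by apply: subincl_surj; rewrite /= linear0 (exact0 _ fg) subrr.
  - by exists i.
pose p : {linear Q -> M} := fst \o subincl (ker_submod k).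
have [||a|r ri] := ext _ _ i p _ _ idfun.
- apply/exactP => z; split=> [z0|[a <-]]; last by rewrite /p /= iE.
  have /exactP/(_ (val z).2)[] := fg; rewrite -kQ.
  have {}z0 : (val z).1 = 0 by [].
  rewrite z0 linear0 => /(_ erefl)[a az] _; exists a; apply: val_inj.
  by rewrite iE az -z0; case: (val z).
- apply/surjP => x; have [y yx] := gs (h x).
  by have [z zE] := Qk _ _ (esym yx); exists z;
    rewrite /p /= -[submod_val z]/(val z) zE.
- by move/(congr1 val); rewrite iE => -[]; exact: inj_eq0.
pose v : {linear Q -> B} := (snd \o subincl (ker_submod k)) \- (f \o r).
have [x|z pz|h' h'E] := @descend _ _ _ _ p v.
- have [y yx] := gs (h x); have [z zE] := Qk _ _ (esym yx).
  by exists z; rewrite /p /= -[submod_val z]/(val z) zE.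
- have : g (val z).2 = 0 by rewrite -kQ -[(val z).1]/(p z) pz linear0.
  have /exactP/(_ (val z).2)[H _] := fg; move=> /H[a az].
  have -> : z = i a.
    have z1 : (val z).1 = 0 by [].
    by apply: val_inj; rewrite iE az -z1; case: (val z).
  by rewrite /v /= -[submod_val (i a)]/(val (i a)) iE ri subrr.
exists h' => x; have [y yx] := gs (h x); have [z zE] := Qk _ _ (esym yx).
have <- : p z = x by rewrite /p /= -[submod_val z]/(val z) zE.
rewrite h'E /v linearB (exact0 _ fg) subr0 /= -[submod_val z]/(val z).
by rewrite -kQ.
Qed.

(** Extend [c \o f] to [F : Q -> I0] and let [g \o F] descend to [h] on [M]. Subtracting a lift of
    [h] from [F] pushes [F] into [C] without changing it on [N]. *)
Lemma ext_lift_injdim1 M C I0 I1 (c : {linear C -> I0}) (g : {linear I0 -> I1})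
  :
  injective_module I0 -> short_exact c g ->
  (forall h : {linear M -> I1}, exists h' : {linear M -> I0},
    forall x, g (h' x) = h x) -> ext_lift M C.
Proof.
move=> injI0 [ci cg gs] lift N Q i p ip ps f kif.
have [F Fi] : exists F : {linear Q -> I0}, forall n, F (i n) = c (f n).
  by apply: (inj_ext (f := c \o f)) => // n /kif /= ->; rewrite linear0.
have [|q pq|h hp] := @descend _ _ _ _ p (g \o F); first exact/surjP.
  have /exactP/(_ q)[/(_ pq)[n <-] _] := ip.
  by rewrite /= Fi (exact0 _ cg).
have [h' gh'] := lift h.
have [q|k kE] := @lift_inj _ _ _ _ c (F \- (h' \o p)) ci.
  have /exactP/(_ ((F \- (h' \o p)) q))[H _] := cg; apply: H.
  by rewrite linearB /= gh' hp subrr.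
exists k => n; apply: ci; rewrite kE /= Fi (exact0 _ ip) linear0 subr0 //.
Qed.

(** A map [N -> I1] extends to [M] because [I1] is injective, lifts to [I0] there, and the lift
    restricts to [N]. *)
Lemma ext_lift_sub M N C (j : {linear N -> M}) :
  injdim_le1 C -> injective j -> ext_lift M C -> ext_lift N C.
Proof.
move=> [I0 [I1 [c [g [injI0 injI1 cg]]]]] ji ext.
apply: (ext_lift_injdim1 injI0 cg) => h.
have [k kj] := injI1 _ _ j h ji.
have [h' gh'] := ext_lift_hom ext cg k.
by exists (h' \o j) => x /=; rewrite gh' kj.
Qed.

Lemma ext_lift_power M C X : ext_lift M C -> ext_lift M (power C X).
Proof.
move=> ext N Q i p ip ps f kif.
have lf x : linear (fun n => f n x : C) by move=> a m n; rewrite linearP.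
have /choice[g gi] x : exists g : {linear Q -> C}, forall n, g (i n) = f n x.
  by apply: (ext _ _ i p ip ps (Lin (lf x))) => n /kif /= ->.
have lg : linear (fun n x => g x n : C).
  by move=> a m n; apply/funext => x; rewrite linearP.
by exists (@Lin _ _ (power C X) _ lg) => n; apply/funext => x /=.
Qed.

Lemma ext_lift_retract M A B (r : {linear A -> B}) (s : {linear B -> A}) :
  cancel s r -> ext_lift M A -> ext_lift M B.
Proof.
move=> sK ext N Q i p ip ps f kif.
have [n /kif|g gi] := ext _ _ i p ip ps (s \o f).
  by move=> /= ->; rewrite linear0.
by exists (r \o g) => n /=; rewrite gi /= sK.
Qed.

End Ext.

(** * Modules cogenerated by a cotilting module, injective envelopes *)

Section Cotilting.
Variable R : comPzRingType.
Implicit Types A B C D E I J M N P Q S V W : lmodType R.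

(** Elementwise form of [C] cogenerating [M], that is, of [M] embedding into a power of [C]. *)
Definition separated C M :=
  forall x : M, x <> 0 -> exists phi : {linear M -> C}, phi x <> 0.

Lemma separated_embeds C M : separated C M ->
  exists i : {linear M -> power C M}, injective i.
Proof.
move=> sepM.
have /choice[phi phiP] (x : M) :
    exists phi : {linear M -> C}, x <> 0 -> phi x <> 0.
  have [->|/eqP/sepM[phi phix]] := eqVneq x 0; first by exists \0.
  by exists phi.
have li : linear (fun x y => phi y x : C).
  by move=> a x y; apply/funext => z; rewrite linearP.
exists (@Lin _ _ (power C M) _ li); apply: lin_inj => x /= x0.
by apply: contrapT => /phiP; apply; exact: (congr1 (@^~ x) x0).
Qed.

Lemma separated_power C X : separated C (power C X).
Proof.
move=> x x0; have [k xk] : exists k, x k <> 0.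
  by apply: contrapT => /forallNP h; apply: x0; apply/funext => k;
    apply: contrapT.
have lk : linear (fun x : power C X => x k) by [].
by exists (Lin lk).
Qed.

Lemma separated_sub C M N (j : {linear N -> M}) :
  injective j -> separated C M -> separated C N.
Proof.
move=> ji sepM x x0; have [|phi phix] := sepM (j x).
  by move/(inj_eq0 ji).
by exists (phi \o j).
Qed.

Lemma separated_trans C E M : separated C E -> separated E M -> separated C M.
Proof.
move=> sepE sepM x /sepM[phi /sepE[psi px]].
by exists (psi \o phi).
Qed.

Lemma Prod_retract C A : Prod C A ->
  exists X (s : {linear A -> power C X}) (r : {linear power C X -> A}),
    cancel s r.
Proof.
move=> [X [N [phi [psi phiK psiK]]]].
have [|x|g gK] := @lift_inj _ _ _ _ phi idfun; first exact: can_inj phiK.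
  by exists (psi x); rewrite psiK.
have la : linear (fun a : A => (a, 0 : N)).
  by move=> r a b; congr (_, _); rewrite -[RHS]/(r *: 0 + 0) scaler0 addr0.
exists X, (phi \o Lin la), (fst \o g) => a /=.
by rewrite (can_inj phiK (gK _)).
Qed.

Lemma retract_Prod C A X (s : {linear A -> power C X})
  (r : {linear power C X -> A}) : cancel s r -> Prod C A.
Proof.
move=> sK; exists X, (submod (ker_submod r)).
pose phi : {linear (A * submod (ker_submod r))%type -> power C X} :=
  (s \o fst) \+ (subincl (ker_submod r) \o snd).
exists phi; have kr (z : submod (ker_submod r)) : r (subincl _ z) = 0.
  exact: (subinclP z).
have phi_inj : injective phi.
  apply: lin_inj => -[a z] /= az; have a0 : a = 0.
    by have := congr1 r az; rewrite linearD sK kr addr0 linear0.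
  congr (_, _); first exact: a0.
  apply: (@subincl_inj _ _ _ (ker_submod r)).
  by move: az; rewrite a0 linear0 add0r linear0.
have phi_surj y : exists x, phi x = y.
  have [|z zE] := @ker_mem _ _ _ r (y - s (r y)).
    by rewrite linearB sK subrr.
  by exists (r y, z); rewrite /= -[submod_val z]/(subincl _ z) zE addrC subrK.
have [psi psiK] := choice phi_surj.
by exists psi => // x; apply: phi_inj; rewrite psiK.
Qed.

Lemma injective_separated_Prod C E :
  injective_module E -> separated C E -> Prod C E.
Proof.
move=> injE /separated_embeds[i ii].
have [r ri] := injE _ _ i idfun ii.
exact: retract_Prod ri.
Qed.

Lemma Prod_separated C A : Prod C A -> separated C A.
Proof.
move=> /Prod_retract[X [s [r sK]]].
apply: (separated_sub (can_inj sK)); exact: separated_power.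
Qed.

Lemma left_perp_separated C M :
  one_cotilting C -> (left_perp C M <-> separated C M).
Proof.
move=> [idC extC [C1 [C0 [W [f [g [PC1 PC0 _ cogW fg]]]]]]]; split; last first.
  move=> /separated_embeds[i ii]; apply/Ext1_zeroE.
  by apply: (ext_lift_sub idC ii); apply/Ext1_zeroE.
move=> /Ext1_zeroE ext; have [X [i ii]] := cogW M.
have [Y [s [r sK]]] := Prod_retract PC1.
(* Vanishing of Ext^1(M, -) passes from [C] to its powers and their summands, hence to [C1]; this
   lets maps from [M] to [W] lift to [C0]. *)
have extC1 : ext_lift M C1 by apply: (ext_lift_retract sK);
  exact: ext_lift_power.
move=> x x0; have [|psi psix] := @separated_power W X (i x).
  by move/(inj_eq0 ii).
have [h gh] := ext_lift_hom extC1 fg (psi \o i).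
have [|phi phix] := @Prod_separated C C0 PC0 (h x).
  by move=> hx; apply: psix; rewrite -[LHS]gh hx linear0.
by exists (phi \o h).
Qed.

Lemma submoduleP V (U : set V) : GRing.submod_closed [in U] <->
  U 0 /\ forall (a : R) x y, U x -> U y -> U (a *: x + y).
Proof.
split=> [[/set_mem U0 UP]|[U0 UP]]; split => //.
- by move=> a x y /mem_set Ux /mem_set Uy; apply: set_mem; exact: UP.
- exact: mem_set.
- by move=> a x y /set_mem Ux /set_mem Uy; apply: mem_set; exact: UP.
Qed.

Definition add_line V (U : set V) (t : V) : set V :=
  [set x | exists r u, U u /\ x = u + r *: t].

Lemma add_line_submod V (U : set V) t : GRing.submod_closed [in U] ->
  GRing.submod_closed [in add_line U t].
Proof.
move=> /submoduleP[Y0 YP]; apply/submoduleP; split.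
  by exists 0, 0; rewrite scale0r addr0.
move=> a _ _ [r [u [Yu ->]]] [s [v [Yv ->]]].
exists (a * r + s), (a *: u + v); split; first exact: YP.
by rewrite scalerDr scalerDl scalerA addrACA.
Qed.

(** * Relative complements and existence of injective envelopes *)

(** Zorn's lemma. The last clause is maximality: adjoining a line outside [Y] must create a nonzero
    element of [A]. *)
Lemma complement_exists V (A Y0 : set V) :
  GRing.submod_closed [in Y0] -> A `&` Y0 `<=` [set 0] ->
  exists Y : set V, [/\ GRing.submod_closed [in Y], Y0 `<=` Y,
    A `&` Y `<=` [set 0] & forall x, ~ Y x ->
    exists r y a, [/\ Y y, A a, a <> 0 & a = y + r *: x]].
Proof.
move=> /submoduleP subY0 AY0.
pose good Y := [/\ GRing.submod_closed [in Y],
  Y0 `<=` Y & A `&` Y `<=` [set 0]].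
pose P := [set Y : set V | Y = set0 \/ good Y].
have [F FP totF|Y [PY Ymax]] := @Zorn_bigcup _ P.
  have [[Z [FZ goodZ]]|nF] := pselect (exists Z, F Z /\ good Z); last first.
    left; apply/seteqP; split=> // x [Z FZ Zx].
    case: (FP _ FZ) => [Z0|goodZ]; first by rewrite Z0 in Zx.
    by exfalso; apply: nF; exists Z.
  have [subZ Y0Z AZ] := goodZ; right; split.
  - apply/submoduleP; split; first by exists Z => //;
      have /submoduleP[] := subZ.
    have key a x y X1 X2 : F X1 -> X1 x -> F X2 -> X2 y -> exists2 X,
      F X & X (a *: x + y).
      move=> FX1 X1x FX2 X2y; have [X12|X21] := totF _ _ FX1 FX2.
        exists X2 => //; case: (FP _ FX2) => [X0|[/submoduleP[_ subX] _ _]].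
          by rewrite X0 in X2y.
        by apply: subX => //; exact: X12.
      exists X1 => //; case: (FP _ FX1) => [X0|[/submoduleP[_ subX] _ _]].
        by rewrite X0 in X1x.
      by apply: subX => //; exact: X21.
    by move=> a x y [X1 FX1 X1x] [X2 FX2 X2y];
      have [X] := key a x y _ _ FX1 X1x FX2 X2y; exists X.
  - by move=> x /Y0Z Zx; exists Z.
  - move=> x [Ax [X FX Xx]]; case: (FP _ FX) => [X0|[_ _ AX]].
      by rewrite X0 in Xx.
    by apply: AX; split.
have goodY : good Y.
  case: PY => // Y0'; exfalso; apply: (Ymax Y0).
    split; first by rewrite Y0'.
    by move=> /(_ 0); rewrite Y0'; case: subY0 => Y00 _ /(_ Y00).
  by right; split => //; exact/submoduleP.
have [subY Y0Y AY] := goodY; exists Y; split=> // x nYx.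
apply: contrapT => H; have [Y00 _] := subY0.
apply: (Ymax (add_line Y x)).
  split=> [y Yy|YZ]; first by exists 0, y; rewrite scale0r addr0.
  by apply: nYx; apply: YZ; exists 1, 0; rewrite scale1r add0r; split=> //;
    exact: Y0Y.
right; split; first exact: add_line_submod.
  by move=> y /Y0Y Yy; exists 0, y; rewrite scale0r addr0.
move=> a [Aa [r [y [Yy ay]]]]; apply: contrapT => a0; apply: H.
by exists r, y, a.
Qed.

(* U complements the image of C in I and Y complements U: being a complement of
   a complement, Y is a direct summand of I. *)
Lemma injective_envelope_exists C I (c : {linear C -> I}) :
  injective_module I -> injective c -> exists E, injective_envelope C E.
Proof.
move=> injI ci; have sub0 : GRing.submod_closed [in [set 0 : I]].
  by apply/submoduleP; split=> // a x y /= -> ->; rewrite scaler0 addr0.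
have [|U [subU _ CU essU]] := @complement_exists I (range c) _ sub0.
  by move=> x [].
have [|Y [subY CY UY essY]] := @complement_exists I U _ (range_submod c).
  by rewrite setIC.
have /submoduleP[U0 UP] := subU; have /submoduleP[Y0 YP] := subY.
have YD x y (r : R) : Y x -> Y y -> Y (x - r *: y).
  by move=> Yx Yy; rewrite addrC -scaleNr; exact: YP.
pose i : {linear (submod subY * submod subU)%type -> I} :=
  (subincl subY \o fst) \+ (subincl subU \o snd).
(* [h] extends to [I] the projection of [Y + U] onto [U]. It turns out to be idempotent with image
   [U] and kernel [Y], so that [idfun \- h] retracts [I] onto [Y]. *)
have [[y u] /= /eqP|h hE] := @inj_ext _ I _ _ i (subincl subU \o snd) injI.
  rewrite addr_eq0 => /eqP yu.
  apply: UY; split; first exact: (subinclP u).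
  rewrite -[X in Y X]opprK -yu -[X in Y X]add0r -[X in 0 - X]scale1r.
  exact: YD (subinclP y).
have hU x : U x -> h x = x.
  move=> /(@subincl_surj _ _ _ subU)[u <-].
  rewrite -{1}[subincl _ u]add0r -(linear0 (subincl subY)); exact: hE (0, u).
have hY x : Y x -> h x = 0.
  move=> /(@subincl_surj _ _ _ subY)[y <-].
  rewrite -[subincl _ y]addr0 -[X in _ + X](linear0 (subincl subU)).
  by rewrite [LHS](hE (y, 0)) /=.
have kerhY x : h x = 0 -> Y x.
  move=> hx; apply: contrapT => /essY[r [y [u [Yy Uu u0 uE]]]]; apply: u0.
  by rewrite -(hU u) // uE linearD (hY y) // linearZ_LR hx scaler0 addr0.
have Ch z x : c z = h x -> c z = 0.
  move=> zx; apply: contrapT => z0; have [Yx|] := pselect (Y x).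
    by apply: z0; rewrite zx hY.
  move=> /essY[r [y [u [Yy Uu u0 uE]]]]; apply: u0; apply: CU; split=> //.
  exists (r *: z) => //.
  by rewrite linearZ_LR zx -(hU u) // uE linearD (hY y) // linearZ_LR add0r.
(* By [Ch] the image of [h] meets that of [c] only in zero, so the maximality of [U] forces [h] into
   [U]. *)
have hU' x : U (h x).
  apply: contrapT => /essU[r [u [_ [Uu [z _ <-] z0 zE]]]]; apply: z0.
  by apply: (Ch z (u + r *: x)); rewrite linearD hU // linearZ_LR.
have [x|p pE] := @lift_inj _ _ _ _ _ (idfun \- h) (@subincl_inj _ _ _ subY).
  by apply: subincl_surj; apply: kerhY; rewrite linearB /= [h (h x)]hU ?subrr.
have [x|c' c'E] := @lift_inj _ _ _ _ _ c (@subincl_inj _ _ _ subY).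
  by apply: subincl_surj; apply: CY; exists x.
exists (submod subY); split.
  apply: (@injective_retract _ I _ p (subincl subY)) => // y.
  apply: (@subincl_inj _ _ _ subY); rewrite pE /= [h _]hY ?subr0 //.
  exact: (subinclP y).
exists c'; split=> [|W /submoduleP[W0 WP] Wc v Wv].
  by move=> x y xy; apply: ci; rewrite -!c'E xy.
apply: contrapT => v0; have [|r [u [_ [Uu [z _ <-] z0 zE]]]] := essU (subincl
  subY v).
  move=> Uv; apply: v0; apply: (@subincl_inj _ _ _ subY).
  by rewrite [RHS]linear0; apply: UY; split=> //; exact: (subinclP v).
have u0 : u = 0.
  apply: UY; split=> //; rewrite -[u](addrK (r *: subincl subY v)) -zE.
  by apply: YD; [apply: CY; exists z|exact: (subinclP v)].
have zv : c' z = r *: v.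
  by apply: (@subincl_inj _ _ _ subY); rewrite c'E zE u0 add0r linearZ_LR.
apply: z0; rewrite -c'E (Wc (c' z)) ?linear0 //; split; last by exists z.
by rewrite zv -[X in W X]addr0; exact: WP.
Qed.

End Cotilting.

(** * Essential extensions and the equivalence with membership in Prod *)

Section Envelopes.
Variable R : comPzRingType.
Implicit Types A B C D E I J M N P Q S V W : lmodType R.

Definition essential M E (i : {linear M -> E}) :=
  injective i /\
  forall y : E, y <> 0 -> exists r x, x <> 0 /\ i x = r *: y.

Lemma envelope_essential M E : injective_envelope M E ->
  injective_module E /\ exists i : {linear M -> E}, essential i.
Proof.
move=> [injE [i [ii essi]]]; split=> //; exists i; split=> // y y0.
apply: contrapT => H; apply: y0.
apply: (essi _ (range_submod (elt y))); last by exists 1; rewrite //= scale1r.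
move=> _ [[r _ <-] [x _ xr]]; apply: contrapT => ry; apply: H.
by exists r, x; split=> // x0; apply: ry; rewrite -xr x0 linear0.
Qed.

Lemma essential_inj M E V (i : {linear M -> E}) (k : {linear E -> V}) :
  essential i -> injective (k \o i) -> injective k.
Proof.
move=> [ii essi] kii; apply: lin_inj => y ky; apply: contrapT => /essi.
move=> [r [x [x0 xy]]]; apply: x0; apply: (inj_eq0 kii) => /=.
by rewrite xy linearZ_LR ky scaler0.
Qed.

Lemma separated_refl C : separated C C.
Proof. by move=> x x0; exists idfun. Qed.

Lemma separated_env C E M : injective_envelope C E -> separated C M ->
  separated E M.
Proof.
move=> /envelope_essential[_ [i [ii _]]] sepM.
by apply: separated_trans sepM; apply: separated_sub ii _;
  exact: separated_refl.
Qed.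

Lemma cotilting_envelope C :
  one_cotilting C -> exists E, injective_envelope C E.
Proof.
move=> [[I0 [I1 [c [g [injI0 _ [ci _ _]]]]]] _ _].
exact: injective_envelope_exists ci.
Qed.

Lemma closed_envelopes_Prod (K : lmodType R -> Prop) :
  one_cotilting_class K ->
  closed_injective_envelopes K <->
  (forall C, one_cotilting C -> (forall M, K M <-> left_perp C M) ->
   forall E, injective_envelope C E -> Prod C E).
Proof.
move=> [C cotC KC]; split=> [closedK D cotD KD E envE|PE M E KM envE].
  apply: injective_separated_Prod; first by case: envE.
  apply/(left_perp_separated _ cotD)/KD; apply: closedK envE.
  apply/KD/(left_perp_separated _ cotD); exact: separated_refl.
have [E0 envE0] := cotilting_envelope cotC.
have sepE0 := Prod_separated (PE _ cotC KC _ envE0).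
apply/KC/(left_perp_separated _ cotC).
have /KC/(left_perp_separated _ cotC)/(separated_env envE0) := KM.
move=> /separated_embeds[j ji].
have [injE [i essi]] := envelope_essential envE.
(* The embedding of [M] into a power of the envelope [E0] of [C] extends to [E] by injectivity of
   that power, and stays injective because [E] is essential over [M]. *)
have [k ki] := @injective_power _ E0 M (proj1 envE0) _ _ i j (proj1 essi).
have ki_inj : injective k.
  apply: (essential_inj essi) => x y /=; rewrite !ki; exact: ji.
apply: separated_trans sepE0 _; apply: (separated_sub ki_inj).
exact: separated_power.
Qed.

End Envelopes.

(** * Tor and linear systems *)

Section Tor.
Variable R : comPzRingType.
Implicit Types A B C D E I J M N P Q S V W : lmodType R.

Lemma tensor_lin_eq M N V (f g : {linear tensor M N -> V}) :
  (forall m n, f (tens m n) = g (tens m n)) -> f =1 g.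
Proof.
move=> fg; elim/quotW=> u.
have lp : linear (\pi_(tensor M N) : free_mod R (M * N) -> tensor M N).
  by move=> a v w; rewrite raddfD pi_tensorZ.
apply: (@free_lin_eq _ _ _ (f \o Lin lp) (g \o Lin lp)) => -[m n] /=.
exact: fg.
Qed.

Lemma tensor_map_comp M A B C (f : {linear A -> B}) (g : {linear B -> C})
    (h : {linear A -> C}) : (forall x, h x = g (f x)) ->
  forall z, tensor_map M h z = tensor_map M g (tensor_map M f z).
Proof.
move=> hE; apply: (@tensor_lin_eq _ _ _ (tensor_map M h)
  (tensor_map M g \o tensor_map M f)) => m n /=.
by rewrite !tensor_mapE hE.
Qed.

Lemma tens0 M N (m : M) : tens m (0 : N) = 0.
Proof. by have := linear0 (Lin (@tens_linearr R M N m)). Qed.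

Lemma tensD M N (m : M) (x y : N) : tens m (x + y) = tens m x + tens m y.
Proof. exact: linearD (Lin (@tens_linearr R M N m)) x y. Qed.

Lemma tensor_map_add M A B (f g h : {linear A -> B}) :
  (forall x, h x = f x + g x) ->
  forall z, tensor_map M h z = tensor_map M f z + tensor_map M g z.
Proof.
move=> hE; apply: (@tensor_lin_eq _ _ _ (tensor_map M h)
  (tensor_map M f \+ tensor_map M g)) => m n /=.
by rewrite !tensor_mapE hE tensD.
Qed.

Lemma tensor_map0 M A B (h : {linear A -> B}) :
  (forall x, h x = 0) -> forall z, tensor_map M h z = 0.
Proof.
move=> h0; apply: (@tensor_lin_eq _ _ _ (tensor_map M h) \0) => m n /=.
by rewrite tensor_mapE h0 tens0.
Qed.

Lemma tensor_map_id M A (h : {linear A -> A}) :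
  (forall x, h x = x) -> forall z, tensor_map M h z = z.
Proof.
move=> h1; apply: (@tensor_lin_eq _ _ _ (tensor_map M h) idfun) => m n /=.
by rewrite tensor_mapE h1.
Qed.

Section TwoTermResolution.
Variables (S Q1 Q0 : lmodType R) (d : {linear Q1 -> Q0}) (q : {linear Q0 -> S}).
Hypotheses (proj1Q : projective_module Q1) (proj0Q : projective_module Q0).
Hypothesis dq : short_exact d q.

Definition two_term_mod n : lmodType R :=
  match n with 0 => Q0 | 1 => Q1 | _ => 'rV[R]_0 end%N.

Definition two_term_d n : {linear two_term_mod n.+1 -> two_term_mod n} :=
  match n with 0 => d | _ => \0 end%N.

Definition two_term_resolution : projective_resolution S.
Proof.
apply: (@ProjectiveResolution R S two_term_mod two_term_d q).
- by case=> [|[|n]] //; exact: rV_projective.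
- by case: dq.
- by case: dq.
- case: dq => di _ _; case=> [|n]; apply/exactP => y /=; split.
  + by move/(inj_eq0 di) ->; exists 0.
  + by case=> x <-; exact: linear0.
  + by move=> _; exists 0; apply/rowP; case.
  + by [].
Defined.

(** For the two-term resolution, Tor_1 is the kernel of [tensor_map M d]. Another resolution [P] is
    compared with it by chain maps [f] and [g] and a homotopy [h] from the identity to [g \o f]: a
    cycle [z] has [f1 z = 0] after tensoring, so it is the boundary of [h1 z]. *)
Lemma Tor1_zero_two_term M :
  Tor1_zero M S <-> injective (tensor_map M d).
Proof.
have [di dqe qs] := dq; split=> [/(_ two_term_resolution)/exactP tor|mdi P].
  apply: lin_inj => z dz.
  by have [/(_ dz)[w <-] _] := tor z; apply: tensor_map0.
have [f0 qf0] : exists f0 : {linear P 0%N -> Q0}, forall x,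
  q (f0 x) = res_aug P x.
  by apply: (@res_projective _ _ P 0%N); exact: qs.
have [x|f1 df1] := @lift_inj _ _ _ _ d (f0 \o res_d P 0) di.
  have /exactP/(_ (f0 (res_d P 0 x)))[+ _] := dqe; apply.
  by rewrite qf0 (exact0 _ (res_exact0 P)).
have [g0 pg0] : exists g0 : {linear Q0 -> P 0%N}, forall x,
  res_aug P (g0 x) = q x.
  by apply: proj0Q; exact: res_aug_surj.
have [x|g1 dg1] := @proj_lift _ _ _ _ (res_d P 0) (g0 \o d) proj1Q.
  have /exactP/(_ (g0 (d x)))[+ _] := res_exact0 P; apply.
  by rewrite pg0 (exact0 _ dqe).
have [x|h0 dh0] := @proj_lift _ _ _ _ (res_d P 0) (idfun \- (g0 \o f0))
    (@res_projective _ _ P 0%N).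
  have /exactP/(_ (x - g0 (f0 x)))[+ _] := res_exact0 P; apply.
  by rewrite linearB pg0 qf0 subrr.
have [x|h1 dh1] := @proj_lift _ _ _ _ (res_d P 1)
    ((idfun \- (g1 \o f1)) \- (h0 \o res_d P 0)) (@res_projective _ _ P 1%N).
  have /exactP/(_ (x - g1 (f1 x) - h0 (res_d P 0 x)))[+ _] := res_exactS P 0.
  by apply; rewrite !linearB dh0 dg1 /= df1 /= subrr.
have split1 x : x = (g1 (f1 x) + h0 (res_d P 0 x)) + res_d P 1 (h1 x).
  by rewrite dh1 /= -(addrA x) -opprD [RHS]addrC subrK.
apply/exactP => z; split=> [dz|[w <-]]; last first.
  rewrite /= -(@tensor_map_comp _ _ _ _ _ _ \0) ?tensor_map0 // => x /=.
  by rewrite (exact0 _ (res_exactS P 0)).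
have f1z : tensor_map M f1 z = 0.
  apply: (inj_eq0 mdi) => /=.
  rewrite -(@tensor_map_comp _ _ _ _ _ _ (f0 \o res_d P 0)) => [|x];
    last exact/esym/df1.
  by rewrite (@tensor_map_comp _ _ _ _ (res_d P 0) f0) // dz linear0.
exists (tensor_map M h1 z).
rewrite -[RHS](@tensor_map_id _ _ idfun) //.
rewrite (@tensor_map_add _ _ _ ((g1 \o f1) \+ (h0 \o res_d P 0)) (res_d P 1 \o
  h1) idfun) //.
rewrite (@tensor_map_add _ _ _ (g1 \o f1) (h0 \o res_d P 0)) //.
rewrite (@tensor_map_comp _ _ _ _ f1 g1) // f1z linear0 add0r.
rewrite (@tensor_map_comp _ _ _ _ (res_d P 0) h0) // dz linear0 add0r.
by rewrite (@tensor_map_comp _ _ _ _ h1 (res_d P 1)).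
Qed.

End TwoTermResolution.

Definition only_zero_solution (m : nat) (W : set ('I_m -> R)) M :=
  forall x : 'I_m -> M,
  (forall w, W w -> \sum_k w k *: x k = 0) -> forall k, x k = 0.

Section Contraction.
Variables (M Q : lmodType R) (phi : {linear Q -> R^o}).

Let contr_linearr (m : M) : linear (fun y : Q => (phi y : R) *: m).
Proof. by move=> a x y; rewrite linearP scalerDl scalerA. Qed.

Let contr_linearl (y : Q) : linear (fun m : M => (phi y : R) *: m).
Proof. by move=> a m n; rewrite scalerDr !scalerA mulrC. Qed.

(** This is [M (x) phi] followed by the identification of [M (x) R] with [M]. *)
Definition contraction : {linear tensor M Q -> M} :=
  Lin (tensor_lift_is_linear contr_linearr contr_linearl).

Lemma contractionE m y : contraction (tens m y) = (phi y : R) *: m.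
Proof. exact: (tensor_liftE contr_linearr contr_linearl). Qed.

End Contraction.

Lemma contraction_map M A B (d : {linear A -> B}) (phi : {linear B -> R^o}) z :
  contraction M phi (tensor_map M d z) = contraction M (phi \o d) z.
Proof.
apply: (@tensor_lin_eq _ _ _ (contraction M phi \o tensor_map M d)) => a b.
rewrite contractionE -[LHS]/(contraction M phi (tensor_map M d (tens a b))).
by rewrite tensor_mapE contractionE.
Qed.

(* The y k and the coordinates of s form a dual basis of Q1, through which
   M (x) Q1 becomes the solution set of x k = \sum_j s (y j) k *: x j. *)
Lemma tensor_map_inj_system M m n (Q1 : lmodType R)
    (d : {linear Q1 -> 'rV[R]_n}) (p : {linear 'rV[R]_m -> Q1})
    (s : {linear Q1 -> 'rV[R]_m}) : cancel s p ->
  let y k := p (delta_mx 0 k) in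
  injective (tensor_map M d) <->
  only_zero_solution
    ([set w | exists l, forall k, w k = d (y k) 0 l] `|`
     [set w | exists j, forall k, w k = (k == j)%:R - s (y k) 0 j]) M.
Proof.
move=> sK y.
have lc (h : nat) (k : 'I_h) : linear (fun v : 'rV[R]_h => v 0 k : R^o).
  by move=> a u v; rewrite !mxE.
pose sk k : {linear Q1 -> R^o} := Lin (lc _ k) \o s.
pose T (x : 'I_m -> M) : tensor M Q1 := \sum_k tens (x k) (y k).
have tensZ N (c : R) (a : M) (b : N) : tens a (c *: b) = c *: tens a b.
  exact: linearZ_LR (Lin (@tens_linearr R M N a)) c b.
have tensZl N (c : R) (a : M) (b : N) : tens (c *: a) b = c *: tens a b.
  exact: linearZ_LR (Lin (@tens_linearl R M N b)) c a.
have tens_sum N K (a : M) (b : 'I_K -> N) : tens a (\sum_k b k) = \sum_k tens a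
  (b k).
  exact: (linear_sum (Lin (@tens_linearr R M N a))).
have tens_suml N K (a : 'I_K -> M) (b : N) : tens (\sum_k a k) b = \sum_k tens
  (a k) b.
  exact: (linear_sum (Lin (@tens_linearl R M N b))).
have decomp z : z = T (fun k => contraction M (sk k) z).
  have lT : linear (fun z : tensor M Q1 => T (fun k => contraction M (sk k) z)).
    move=> a u v; rewrite /T scaler_sumr -big_split; apply: eq_bigr => k _.
    by rewrite linearP tens_linearl.
  apply: (@tensor_lin_eq _ _ _ idfun (Lin lT)) => a b.
  rewrite -[RHS]/(T (fun k => contraction M (sk k) (tens a b))) /T.
  rewrite -[LHS]/(tens a b) -{1}[b]sK [s b]row_sum_delta linear_sum tens_sum.
  by apply: eq_bigr => k _; rewrite contractionE linearZ_LR tensZ tensZl.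
have contrT (phi : {linear Q1 -> R^o}) x :
    contraction M phi (T x) = \sum_k (phi (y k) : R) *: x k.
  by rewrite linear_sum; apply: eq_bigr => k _; rewrite contractionE.
(* The second family of equations says that [x] is the coordinate vector of the tensor [T x]. *)
have eqs x j : \sum_k ((k == j)%:R - s (y k) 0 j) *: x k
    = x j - contraction M (sk j) (T x).
  rewrite contrT -(big_rmcond_in (fun=> true)) //.
  rewrite (eq_bigr (fun k => (k == j)%:R *: x k - (sk j (y k) : R) *: x k)) =>
    [|k _]; last first.
    by rewrite scalerBl.
  rewrite sumrB (bigD1 j) //= eqxx scale1r big1 ?addr0 // => k /negPf ->.
  by rewrite scale0r.
split=> [dinj x xsol k|sol].
  have Tx0 : T x = 0.
    apply: (inj_eq0 dinj); rewrite linear_sum.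
    rewrite (eq_bigr (fun k => \sum_l d (y k) 0 l *: tens (x k) (delta_mx 0
      l))) => [|i _]; last first.
      rewrite /= tensor_mapE {1}[d _]row_sum_delta tens_sum.
      by apply: eq_bigr => l _; rewrite tensZ.
    rewrite exchange_big big1 //= => l _.
    rewrite (eq_bigr (fun i => tens (d (y i) 0 l *: x i) (delta_mx 0 l))) =>
      [|i _]; last first.
      by rewrite tensZl.
    rewrite -tens_suml xsol; last by left; exists l.
    exact: (linear0 (Lin (@tens_linearl R M _ _))).
  have := eqs x k; rewrite Tx0 linear0 subr0 => <-.
  by apply: xsol; right; exists k.
apply: lin_inj => z dz; rewrite [z]decomp /T big1 // => k _.
have -> : contraction M (sk k) z = 0.
  apply: (sol (fun k => contraction M (sk k) z)) => w [[l wE]|[j wE]].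
    transitivity (contraction M (Lin (lc _ l) \o d) z); last first.
      by rewrite -contraction_map dz linear0.
    rewrite [in RHS](decomp z) contrT; apply: eq_bigr => i _.
    by rewrite wE.
  rewrite (eq_bigr _ (fun k _ => congr1 (fun c => c *: _) (wE k))) eqs.
  by rewrite -decomp subrr.
exact: (linear0 (Lin (@tens_linearl R M _ _))).
Qed.

End Tor.

(** * McCoy's theorem *)

Section McCoy.
Variable R : comPzRingType.
Implicit Types A B C D E I J M N P Q S V W : lmodType R.

Lemma sub_add_line V (U : set V) t : U `<=` add_line U t.
Proof. by move=> u Uu; exists 0, u; rewrite scale0r addr0. Qed.

Lemma foldl_add_line V (s : seq V) (U : set V) :
  GRing.submod_closed [in U] ->
  [/\ GRing.submod_closed [in foldl (@add_line R V) U s],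
      U `<=` foldl (@add_line R V) U s &
      forall t, t \in s -> foldl (@add_line R V) U s t].
Proof.
elim: s U => [|t s IH] U subU; first by split=> // t.
have [subF UF sF] := IH _ (@add_line_submod R V U t subU).
split=> // [u /(@sub_add_line _ _ t)/UF //|x].
rewrite inE => /predU1P[->|/sF //]; apply: UF.
by exists 1, 0; rewrite scale1r add0r; have /submoduleP[] := subU.
Qed.

(* McCoy's theorem on injectivity of matrices acting on M, with the ideal of
   maximal minors replaced by the annihilator of the cokernel T / U. *)
Lemma annihilator_faithful M (T : lmodType R) (s : seq T) (U : set T) :
  GRing.submod_closed [in U] -> (forall y, foldl (@add_line R T) U s y) ->
  (forall phi : {linear T -> M}, (forall u, U u -> phi u = 0) ->
    forall y, phi y = 0) ->
  forall x : M, x <> 0 -> exists a : R, (forall y, U (a *: y)) /\ a *: x <> 0.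
Proof.
elim: s U => [|t s IH] U subU gen hom0 x x0.
  by exists 1; rewrite scale1r; split=> // y; exact: gen.
have /submoduleP[U0 UP] := subU.
have {}IH (z : M) : z <> 0 -> exists a : R,
    (forall y, add_line U t (a *: y)) /\ a *: z <> 0.
  move=> z0; apply: (IH (add_line U t)) => //; first exact: add_line_submod.
  by move=> phi phi0; apply: hom0 => u /(@sub_add_line _ _ t); exact: phi0.
apply: contrapT => nx.
have [a [aT ax]] := IH x x0; have [b [bT bax]] := IH _ ax.
(* If no scalar works for [x], then [y] is sent to [r *: (a *: x)] whenever [b *: y] and [r *: t]
   agree modulo [U]. This kills [U] but takes the nonzero value [b *: (a *: x)] at [t]. *)
have subD : GRing.submod_closed [in [set z : T * R^o | U (b *: z.1 - z.2 *:
  t)]].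
  apply/submoduleP; split=> [|c z w /= Uz Uw].
    by rewrite -[_ 0]/(U (b *: 0 - 0 *: t)) scaler0 scale0r subr0.
  have -> : b *: (c *: z.1 + w.1) - (c *: z.2 + w.2) *: t =
      c *: (b *: z.1 - z.2 *: t) + (b *: w.1 - w.2 *: t).
    rewrite scalerDr scalerDl opprD addrACA !scalerBr !scalerA mulrC.
    by rewrite -addrA [- _ + _]addrCA !addrA.
  exact: UP.
pose fstD : {linear submod subD -> T} := fst \o subincl subD.
pose valD : {linear submod subD -> M} := elt (a *: x) \o snd \o subincl subD.
have memD y (r : R) : U (b *: y - r *: t) ->
    exists z, fstD z = y /\ valD z = r *: (a *: x).
  move=> Uyr; have [|z zE] := @subincl_surj _ _ _ subD (y, r); first by [].
  exists z; rewrite -[fstD z]/(subincl subD z).1.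
  by rewrite -[valD z]/((subincl subD z).2 *: (a *: x)) zE.
have [y|z z0|phi phiE] := @descend _ _ _ _ fstD valD.
- have [r [u [Uu yE]]] := bT y; have [|z [zy _]] := memD y r; last by exists z.
  by rewrite yE addrK.
- have z1 : (subincl subD z).1 = 0 by [].
  rewrite -[LHS]/((subincl subD z).2 *: (a *: x)).
  have := subinclP z; move: z1 => /=; case: (submod_val z) => y r /= -> {z z0
    y}.
  rewrite scaler0 sub0r => Urt; rewrite scalerA.
  (* Well-definedness: as [a] maps [T] into [U + R t] and [r *: t] is in [U], the scalar [r * a]
     maps [T] into [U], so by [nx] it kills [x]. *)
  apply: contrapT => rax; apply: nx; exists (r * a); split=> // y.
  have [c [u [Uu yE]]] := aT y; rewrite -scalerA yE scalerDr scalerA mulrC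
    -scalerA.
  have -> : r *: u + c *: (r *: t) = (- c) *: (- (r *: t)) + (r *: u + 0).
    by rewrite scalerN scaleNr opprK addr0 addrC.
  by apply: (UP _ _ _ Urt); apply: UP.
have {}phiE y (r : R) : U (b *: y - r *: t) -> phi y = r *: (a *: x).
  by move=> /memD[z [<- <-]].
apply: bax; rewrite -(phiE t) ?subrr //; apply: hom0 => u Uu.
rewrite (phiE u 0) ?scale0r // subr0 -[X in U X]addr0; exact: UP.
Qed.

(** Let [U] be the module of all relations satisfied by a solution [y] in [E]. A map from R^m / U to
    [M] is a solution in [M], hence zero. If [r *: y k = i x] with [x] nonzero, McCoy's theorem
    gives [a] with [a *: x] nonzero and a R^m inside [U]; then [a *: y k = 0], a contradiction. *)
Lemma only_zero_solution_essential m (W : set ('I_m -> R)) M E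
    (i : {linear M -> E}) :
  essential i -> only_zero_solution W M -> only_zero_solution W E.
Proof.
move=> [ii essi] solM y ysol k; apply: contrapT => /essi[r [x [x0 xE]]].
have lsol (x' : 'I_m -> E) : linear (fun v : 'rV[R]_m => \sum_k v 0 k *: x' k).
  move=> c u v; rewrite scaler_sumr -big_split; apply: eq_bigr => j _ /=.
  by rewrite !mxE scalerDl scalerA.
have subU := ker_submod (Lin (lsol y)).
have [subF UF sF] := foldl_add_line [seq delta_mx 0 j | j <- enum 'I_m] subU.
have [||a [aT]] := @annihilator_faithful M 'rV[R]_m
  [seq delta_mx 0 j | j <- enum 'I_m] _ subU _ _ x x0.
- move=> v; rewrite [v]row_sum_delta.
  have /submoduleP[F0 FP] := subF; elim/big_ind: _ => // [u w Fu Fw|j _].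
    by rewrite -[u]scale1r; exact: FP.
  rewrite -[_ *: _]addr0; apply: FP => //; apply: sF; apply: map_f.
  by rewrite mem_enum.
- move=> phi phiU; have phi0 j : phi (delta_mx 0 j) = 0.
    apply: (solM (fun j => phi (delta_mx 0 j))) => w Ww.
    rewrite -[RHS](phiU (\row_j w j)).
      rewrite [X in phi X]row_sum_delta linear_sum; apply: eq_bigr => h _.
      by rewrite linearZ_LR mxE.
    by rewrite /= -[RHS](ysol w Ww); apply: eq_bigr => h _; rewrite mxE.
  move=> v; rewrite [v]row_sum_delta linear_sum big1 // => j _.
  by rewrite linearZ_LR phi0 scaler0.
apply; apply: (inj_eq0 ii); rewrite linearZ_LR xE scalerA mulrC -scalerA.
have := aT (delta_mx 0 k); rewrite /= (bigD1 k) //= big1 => [|j jk].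
  by rewrite !mxE !eqxx addr0 mulr1 => ->; rewrite scaler0.
by rewrite !mxE (negPf jk) mulr0 scale0r.
Qed.

(** An explicit form of Schanuel's lemma. Comparing the two presentations of [S] writes the identity
    of the kernel as a map through [P1] plus a map through R^n; both sources are projective, so both
    terms lift along the surjection [p]. *)
Lemma fp_kernel_dual_basis S m n (f : {linear 'rV[R]_m -> 'rV[R]_n})
    (g : {linear 'rV[R]_n -> S}) :
  exact_at f g -> surjective_map g -> projdim_le1 S ->
  exists (p : {linear 'rV[R]_m -> submod (ker_submod g)})
    (s : {linear submod (ker_submod g) -> 'rV[R]_m}), cancel s p.
Proof.
move=> fg gs [P1 [P0 [t [q [projP1 projP0 [ti tq qs]]]]]].
pose K : lmodType R := submod (ker_submod g).
pose d : {linear K -> 'rV[R]_n} := subincl (ker_submod g).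
have di : injective d by exact: subincl_inj.
have gd z : g (d z) = 0 by exact: (subinclP z).
have [x|p dp] := @lift_inj _ _ _ _ d f di.
  by apply: subincl_surj; exact: exact0 fg.
have ps z : exists x, p x = z.
  have /exactP/(_ (d z))[/(_ (gd z))[x xz] _] := fg.
  by exists x; apply: di; rewrite dp.
have [a0 qa0] : exists a0 : {linear 'rV[R]_n -> P0}, forall x, q (a0 x) = g x.
  exact: rV_projective.
have [z|a1 ta1] := @lift_inj _ _ _ _ t (a0 \o d) ti.
  have /exactP/(_ (a0 (d z)))[+ _] := tq; apply.
  by rewrite qa0 gd.
have [b0 gb0] : exists b0 : {linear P0 -> 'rV[R]_n}, forall x, g (b0 x) = q x.
  exact: projP0.
have [z|b1 db1] := @lift_inj _ _ _ _ d (b0 \o t) di.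
  by apply: subincl_surj; rewrite /= gb0 (exact0 _ tq).
have [z|eta deta] := @lift_inj _ _ _ _ d (idfun \- (b0 \o a0)) di.
  by apply: subincl_surj; rewrite /= linearB /= gb0 qa0 subrr.
have [x|b2 pb2] := @proj_lift _ _ _ _ p b1 projP1; first exact: ps.
have [x|eta2 peta2] := @proj_lift _ _ _ _ p eta (@rV_projective R n);
  first exact: ps.
exists p, ((b2 \o a1) \+ (eta2 \o d)) => z; apply: di.
by rewrite linearD pb2 peta2 linearD db1 deta /= ta1 /= addrC subrK.
Qed.

Lemma Tor1_zero_system S : finitely_presented S -> projdim_le1 S ->
  exists m (W : set ('I_m -> R)), forall M,
    Tor1_zero M S <-> only_zero_solution W M.
Proof.
move=> [m [n [f [g [fg gs]]]]] pdS.
have [p [s sK]] := fp_kernel_dual_basis fg gs pdS.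
have projK := projective_retract sK (@rV_projective R m).
have resS : short_exact (subincl (ker_submod g)) g.
  split=> //; first exact: subincl_inj.
  apply/exactP => y; split=> [/ker_mem //|[z <-]]; exact: (subinclP z).
(* The system, found by unification, is fixed before [M] and so does not depend on it. *)
exists m; eexists => M; split=> [tor|sol].
  apply/(tensor_map_inj_system M (subincl (ker_submod g)) sK).
  by apply/(Tor1_zero_two_term projK (@rV_projective R n) resS).
apply/(Tor1_zero_two_term projK (@rV_projective R n) resS).
by apply/(tensor_map_inj_system M (subincl (ker_submod g)) sK).
Qed.

Lemma cofinite_type_closed_envelopes (K : lmodType R -> Prop) :
  cofinite_type K -> closed_injective_envelopes K.
Proof.
move=> [J [S [fpS KS]]] M E KM envE; apply/KS => j.
have [fpj pdj] := fpS j.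
have [m [W torW]] := Tor1_zero_system fpj pdj.
have [_ [i essi]] := envelope_essential envE.
apply/torW; apply: (only_zero_solution_essential essi).
by apply/torW; move/KS: KM.
Qed.

End McCoy.

(** * Well-ordered chains of annihilated sets *)

Section WellOrderedChains.
Variable R : comPzRingType.
Implicit Types C E M N P Q S W Z : lmodType R.

(** [p] need not be onto: its image is a submodule of [Z], so it is still cogenerated by [C] and has
    no Ext^1 into [C]. *)
Lemma cotilting_extend C Z N Q (i : {linear N -> Q}) (p : {linear Q -> Z})
    (f : {linear N -> C}) :
  one_cotilting C -> separated C Z -> exact_at i p ->
  (forall n, i n = 0 -> f n = 0) ->
  exists g : {linear Q -> C}, forall n, g (i n) = f n.
Proof.
move=> cotC sepZ ip kif.
have [q|p' p'E] := @lift_inj _ _ _ _ _ p (@subincl_inj _ _ _ (range_submod p)).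
  by apply: subincl_surj; exists q.
have : ext_lift (submod (range_submod p)) C.
  apply/Ext1_zeroE/(left_perp_separated _ cotC).
  exact: separated_sub (@subincl_inj _ _ _ (range_submod p)) sepZ.
apply; last exact: kif.
  apply/exactP => q; move/exactP: ip => /(_ q) <-; rewrite -p'E; split=> [->|].
    by rewrite linear0.
  exact: inj_eq0 (@subincl_inj _ _ _ (range_submod p)).
apply/surjP => z; have [q _ qz] := subinclP z; exists q.
by apply: (@subincl_inj _ _ _ (range_submod p)); rewrite p'E.
Qed.

Lemma regular_quotient_ext (L : set R^o) (subL : GRing.submod_closed [in L]) C :
  (forall f : {linear submod subL -> C},
    exists c, forall l, f l = (subincl subL l : R) *: c) ->
  ext_lift (quotmod subL) C.
Proof.
move=> extL.
apply: (@ext_lift_cover _ _ _ _ _ (subincl subL) (quot_map subL)).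
- exact: regular_projective.
- apply/exactP => y; split=> [/quot_map_eq0|[l <-]]; first exact: subincl_surj.
  by apply/quot_map_eq0; exact: subinclP.
- by apply/surjP; exact: quot_map_surj.
- by move=> f _; have [c cE] := extL f; exists (elt c).
Qed.

Definition kills E (A : set R) (e : E) := forall r, A r -> r *: e = 0.

Section Diagonal.
Variables (C E : lmodType R) (I : Type) (lt : I -> I -> Prop).
Hypotheses (cotC : one_cotilting C) (sepE : separated C E).
Hypotheses (lt_wf : well_founded lt)
  (lt_trans : forall i j k, lt i j -> lt j k -> lt i k)
  (lt_total : forall i j, [\/ i = j, lt i j | lt j i])
  (lt_nomax : forall i, exists j, lt i j).
Variables (i0 : I) (J : I -> set R).
Hypothesis J_mono : forall i j, lt i j -> J i `<=` J j.

Definition annL (j : I) : set R^o := [set r | forall e : E,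
  kills (J j) e -> r *: e = 0].
(** The ideal [L] of the diagonal argument, a union of ideals increasing with [j]. *)
Definition annU : set R^o := [set r | exists j, annL j r].

(* A label at j is an arbitrary function to C from the families supported on the
   nodes of height less than j, a node of height i being a sequence of labels at
   all k < i. Hence a map on the bounded families is recorded by a branch. *)
Let family (V : I -> Type) (j : I) :=
  forall i, lt i j -> (forall k, lt k i -> V k) -> E -> E.

Lemma label_exists : exists (V : I -> Type)
  (dec : forall j, V j -> family V j -> C),
  forall j phi, exists v, dec j v = phi.
Proof.
pose step j (rec : forall k, lt k j -> Type) : Type :=
  (forall i (ij : lt i j), (forall k (ki : lt k i), rec k (lt_trans ki ij)) ->
    E -> E) -> C.
pose V := Fix lt_wf (fun _ => Type) step.
(* The recursive equation for labels is only a propositional equality of types; transporting along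
   it still gives a surjective decoding, which is all the diagonal argument asks for. *)
have VE j : V j = (family V j -> C).
  rewrite /V Fix_eq // => k f g fg; congr step.
  by apply/functional_extensionality_dep => l;
    apply/functional_extensionality_dep.
have transport (A B : Type) : A = B -> exists d : A -> B, forall b, exists a,
  d a = b.
  by move=> ->; exists id => b; exists b.
have dP j : exists d : V j -> (family V j -> C), forall b, exists a, d a = b.
  by apply: transport; exact: VE.
exists V, (fun j => projT1 (cid (dP j))) => j; exact: (projT2 (cid (dP j))).
Qed.

Lemma lt_nsym i j : lt i j -> ~ lt j i.
Proof.
elim/(well_founded_ind lt_wf): i j => i IH j ij ji.
exact: (IH _ ji i ji ij).
Qed.

Lemma lt_max i j : exists k, lt i k /\ lt j k.
Proof.
have [<-|ij|ji] := lt_total i j.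
- by have [k ik] := lt_nomax i; exists k.
- by have [k jk] := lt_nomax j; exists k; split=> //; exact: lt_trans jk.
- by have [k ik] := lt_nomax i; exists k; split=> //; exact: lt_trans ik.
Qed.

(** [~ lt i j] expresses that [j] is at most [i], in the shape in which [below] provides it. *)
Lemma kills_mono i j (e : E) : ~ lt i j -> kills (J i) e -> kills (J j) e.
Proof.
have [->//|//|ji] := lt_total i j => _ ei r Jr; exact/ei/(J_mono ji).
Qed.

Lemma annL_mono i j r : lt i j -> annL i r -> annL j r.
Proof.
by move=> /lt_nsym ji Lr e /(kills_mono ji); exact: Lr.
Qed.

Lemma annU_submod : GRing.submod_closed [in annU].
Proof.
apply/submoduleP; split=> [|a x y [i Lx] [j Ly]].
  by exists i0 => e _; rewrite scale0r.
have [k [/annL_mono/(_ Lx) kx /annL_mono/(_ Ly) ky]] := lt_max i j.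
exists k => e ek; rewrite scalerDl.
by rewrite -[a *: x]/(a * x) -scalerA kx // ky // scaler0 addr0.
Qed.

(** * The tree of labels and the diagonal argument *)

Section Branches.
Variables (V : I -> Type) (dec : forall j, V j -> family V j -> C).
Hypothesis dec_surj : forall j phi, exists v, @dec j v = phi.

Definition node := {i : I & forall k, lt k i -> V k}.
Definition branch := forall j, V j.
Definition restr (b : branch) i : node :=
  existT _ i (fun k (_ : lt k i) => b k).

Let Z : lmodType R := power E (node * E)%type.

(** At each node of [b] of height i, [theta b] lists all elements of [E] killed by [J i], so
    [r *: theta b] vanishes there exactly when [annL i r]. Modulo bounded families, [theta b] thus
    generates a copy of [R / L]. *)
Definition theta (b : branch) : Z := fun z =>
  if `[< z.1 = restr b (projT1 z.1) >] && `[< kills (J (projT1 z.1)) z.2 >]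
  then z.2 else 0.

Definition below (j : I) (x : Z) := forall z, ~ lt (projT1 z.1) j -> x z = 0.
Definition bounded : set Z := [set x | exists j, below j x].

Lemma below_mono i j x : lt i j -> below i x -> below j x.
Proof. by move=> ij xi z zj; apply: xi => zi; apply: zj;
  exact: lt_trans ij. Qed.

Lemma bounded_submod : GRing.submod_closed [in bounded].
Proof.
apply/submoduleP; split=> [|a x y [i xi] [j yj]]; first by exists i0.
have [k [/below_mono/(_ xi) kx /below_mono/(_ yj) ky]] := lt_max i j.
exists k => z zk; rewrite -[LHS]/(a *: x z + y z).
by rewrite kx // ky // scaler0 addr0.
Qed.

Lemma theta_restr b b' i e : restr b' i <> restr b i ->
  theta b' (restr b i, e) = 0.
Proof. by rewrite /theta /=; case: asboolP => //= -> /(_ erefl). Qed.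

Lemma theta_self b i e : kills (J i) e -> theta b (restr b i, e) = e.
Proof. by rewrite /theta /= => ei; case: asboolP => //=; case: asboolP. Qed.

Lemma theta_below b j r : annL j r -> below j (r *: theta b).
Proof.
move=> Lr [[i s] e] /= ij; rewrite -[LHS]/(r *: theta b _) /theta /=.
case: ifP => [/andP[_ /asboolP /= ei]|_]; last by rewrite scaler0.
by rewrite Lr //; exact: kills_mono ei.
Qed.

(** Branches with different labels at [j] share no node of height greater than [j], and a finite
    list needs only finitely many such heights. *)
Lemma branch_split (s : seq {classic branch}) (b : branch) : exists i1,
  forall b',
  b' \in s -> b' <> b -> forall i, lt i1 i -> restr b' i <> restr b i.
Proof.
elim: s => [|b1 s [i1 IH]]; first by exists i0.
have [->|b1b] := pselect (b1 = b).
  by exists i1 => b'; rewrite inE => /predU1P[->//|]; exact: IH.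
have [j jb] : exists j, b1 j <> b j.
  apply: contrapT => /forallNP h; apply: b1b.
  by apply/functional_extensionality_dep => j; apply: contrapT.
have [k [ik jk]] := lt_max i1 j.
exists k => b'; rewrite inE => /predU1P[-> _|b's b'b] i ki.
  (* Reading off the label at [j] as an option gives a type not depending on the node, so equality
     of nodes becomes equality of labels. *)
  have ji := lt_trans jk ki; move/(congr1 (fun n : node =>
    if pselect (lt j (projT1 n)) is left jn then Some (projT2 n j jn) else
      None)).
  by case: pselect => //= _ [] /jb.
by apply: IH => //; exact: lt_trans ki.
Qed.

(** Every map from [L] to [C] extends to [R]; by [regular_quotient_ext] this is Ext^1(R / L, C) =
    0. *)
Lemma diagonal_extension (f : {linear submod annU_submod -> C}) :
  exists c, forall l, f l = (subincl annU_submod l : R) *: c.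
Proof.
have [[I0 [I1 [c [h [injI0 _ [ci _ _]]]]]] _ _] := cotC.
apply: contrapT => nf.
pose value (b : branch) (r : R) j : C :=
  dec (b j) (fun i _ s e => r *: theta b (existT _ i s, e)).
pose good b := exists c, forall r j, annL j r -> value b r j = r *: c.
(* The diagonal choice. [good b] says that the map recorded by [b] acts on the bounded multiples of
   [theta b] like a multiplication. [F b] is the non-extendable [f] in that case and zero otherwise,
   so it contradicts the record either way. *)
pose F b : {linear submod annU_submod -> C} := if `[< good b >] then f else \0.
(* [F b] may not extend to [R] with values in [C], but it does in the injective [I0]; [y b] is the
   image of 1. *)
have /choice[y yF] b : exists y : I0, forall l : submod annU_submod,
    (subincl annU_submod l : R) *: y = c (F b l).
  have [|k kE] := @inj_ext _ _ _ _ (subincl annU_submod) (c \o F b) injI0.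
    by move=> l /(inj_eq0 (@subincl_inj _ _ _ annU_submod)) ->; rewrite linear0.
  exists (k 1) => l; rewrite -[RHS]/((c \o F b) l) -kE -linearZ_LR.
  by congr (k _); exact: mulr1.
have [theta' theta'E] := free_lift_ex theta.
have [Y YE] := free_lift_ex y.
pose Phi : lmodType R := free_mod R branch.
have decomp (u : Phi) : exists2 D : seq {classic branch}, uniq D &
    u = \sum_(b <- D) (u b : R) *: @basis_elt R branch b /\
    forall b, b \notin D -> u b = 0.
  exists (fset_set ([set b | u b != 0] : set {classic branch}));
    first exact: fset_uniq.
  split; first exact: free_decomp (free_supp_finite u) _.
  move=> b; rewrite in_fset_set; last exact: free_supp_finite.
  by move=> /negP nb; apply: contrapT => /eqP ub; apply: nb; rewrite inE.
have thetaE (u : Phi) D : u = \sum_(b <- D) (u b : R) *: @basis_elt R branch b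
  ->
    theta' u = \sum_(b <- D) (u b : R) *: theta b.
  move=> {1}->; rewrite linear_sum; apply: eq_bigr => b _.
  by rewrite linearZ_LR theta'E.
have bnd (u : Phi) : (forall b, annU (u b)) -> bounded (theta' u).
  move=> Lu; have [D _ [uE _]] := decomp u; rewrite (thetaE _ _ uE).
  have /submoduleP[B0 BP] := bounded_submod.
  elim/big_ind: _ => // [x z Bx Bz|b _]; first by rewrite -[x]scale1r;
    exact: BP.
  by have [j Lj] := Lu b; exists j; exact: theta_below.
(* High enough on [b], the other branches in the support of [u] have left it, and the coordinates of
   [theta' u] there only see [u b]. *)
have bndL (u : Phi) b : bounded (theta' u) -> annU (u b).
  move=> [j uj]; have [D uD [uE nD]] := decomp u.
  have [bD|/nD ->] := boolP ((b : {classic branch}) \in D); last first.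
    by have /submoduleP[] := annU_submod.
  have [i1 sep] := branch_split D b; have [i [i1i ji]] := lt_max i1 j.
  exists i => e ei; rewrite -(uj (restr b i, e)); last exact: lt_nsym.
  rewrite (thetaE _ _ uE).
  have lev : linear (fun x : Z => x (restr b i, e)) by [].
  rewrite -[RHS]/(Lin lev _) linear_sum (bigD1_seq (b : {classic branch})) //=.
  rewrite -[X in _ = X + _]/((u b : R) *: theta b (restr b i, e)) theta_self //.
  rewrite big_seq_cond big1 ?addr0 // => b' /andP[b'D /eqP b'b].
  by rewrite -[LHS]/((u b' : R) *: theta b' (restr b i,
    e)) theta_restr ?scaler0 //; exact: sep.
have subN : GRing.submod_closed [in [set u : Phi | forall b, annU (u b)]].
  have /submoduleP[L0 LP] := annU_submod.
  apply/submoduleP; split=> [b|a u v /= Lu Lv b]; first exact: L0.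
  by rewrite -[X in annU X]/(a * u b + v b); exact: LP.
pose N : lmodType R := submod subN; pose X0 : lmodType R := submod
  bounded_submod.
pose inX : {linear X0 -> Z} := subincl bounded_submod.
have inX_inj : injective inX by exact: subincl_inj.
have [u|xN xNE] := @lift_inj _ _ _ _ _ (theta' \o subincl subN) inX_inj.
  by apply: subincl_surj; apply: bnd; exact: (subinclP u).
have lfN u : exists w, c w = (Y \o subincl subN) u.
  have [D _ [uE _]] := decomp (subincl subN u).
  suff [w _ wE] : range c (Y (subincl subN u)) by exists w.
  have /submoduleP[c0 cP] := range_submod c.
  rewrite uE linear_sum; elim/big_ind: _ => // [x z cx cz|b _].
    by rewrite -[x]scale1r; exact: cP.
  have [l lE] := @subincl_surj _ _ _ annU_submod _ (subinclP u b).
  by exists (F b l) => //; rewrite -yF linearZ_LR YE lE.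
have [fN fNE] := lift_inj ci lfN.
have liN : linear (fun u : N => (- xN u, subincl subN u) : (X0 * Phi)%type).
  by move=> a u v; rewrite !linearP; congr (_, _); rewrite opprD scalerN.
pose iN : {linear N -> (X0 * Phi)%type} := Lin liN.
pose pQ : {linear (X0 * Phi)%type -> Z} := (inX \o fst) \+ (theta' \o snd).
(* [N] is the kernel of [X0 * Phi -> Z], and [Z] is cogenerated by [C]; so [fN], which acts as [F b]
   on the multiples of the basis element at [b], extends to [g]. *)
have [||n|g gE] := @cotilting_extend C Z _ _ iN pQ fN cotC.
- by apply: separated_trans sepE _; exact: separated_power.
- apply/exactP => -[x u]; split=> [/eqP|[n <-]]; last first.
    rewrite -[LHS]/(inX (- xN n) + theta' (subincl subN n)) linearN xNE.
    exact: addNr.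
  rewrite -[X in X == _]/(inX x + theta' u) addr_eq0 => /eqP xu.
  have [|n nE] := @subincl_surj _ _ _ subN u.
    move=> b; apply: bndL; have /submoduleP[B0 BP] := bounded_submod.
    rewrite -[X in bounded X]opprK -xu -scaleN1r -[X in bounded X]addr0.
    by apply: BP => //; exact: (subinclP x).
  exists n; rewrite /iN /=; congr (_, _); last exact: nE.
  by apply: inX_inj; rewrite linearN xNE [LHS]/= -[submod_val n]/(subincl subN
    n) nE -xu.
- move=> [_ n0]; have -> : n = 0 by apply: (@subincl_inj _ _ _ subN);
    rewrite linear0.
  exact: linear0.
pose g0 (x : X0) : C := g (x, 0).
(* A family in [below j] is determined by its values at heights less than [j], so some label at each
   [j] records [g0]; these labels form the branch [b0]. *)
have [b0 b0E] : exists b0 : branch, forall j x, below j (inX x) ->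
    dec (b0 j) (fun i _ s e => inX x (existT _ i s, e)) = g0 x.
  have code j : exists v : V j, forall x, below j (inX x) ->
      dec v (fun i _ s e => inX x (existT _ i s, e)) = g0 x.
    have /choice[phi phiE] (z : family V j) : exists w, forall x,
      below j (inX x) ->
        z = (fun i _ s e => inX x (existT _ i s, e)) -> w = g0 x.
      have [[x [xj zx]]|nx] := pselect (exists x, below j (inX x) /\
        z = (fun i _ s e => inX x (existT _ i s, e))); last first.
        by exists 0 => x xj zx; exfalso; apply: nx; exists x.
      exists (g0 x) => x' x'j zx'; congr g0; apply: inX_inj.
      apply/funext => -[[i s] e]; have [ij|nij] := pselect (lt i j).
        have /(congr1 (fun w => w i ij s e)) := zx; rewrite zx' => /esym.
        exact.
      by rewrite xj // x'j.
    have [v vE] := dec_surj phi; exists v => x xj.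
    by rewrite vE (phiE _ x xj).
  by exists (fun j => projT1 (cid (code j))) => j;
    exact: (projT2 (cid (code j))).
have bndb r j : annL j r -> bounded (r *: theta b0).
  by move=> Lr; exists j; exact: theta_below.
have valueE r j (Lr : annL j r) : exists2 x : X0, inX x = r *: theta b0 &
    value b0 r j = g0 x.
  have [x xE] := @subincl_surj _ _ _ bounded_submod _ (bndb _ _ Lr).
  have {}xE : inX x = r *: theta b0 by exact: xE.
  exists x => //; rewrite -(b0E j); last by rewrite xE; exact: theta_below.
  by rewrite xE.
pose w := g (0, basis_elt R b0).
have extend (l : submod annU_submod) x : inX x = (subincl annU_submod l : R) *:
  theta b0 ->
    g0 x = (subincl annU_submod l : R) *: w - F b0 l.
  move=> xE; pose r : R := subincl annU_submod l.
  have [n nE] : exists n : N, subincl subN n = r *: basis_elt R b0.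
    apply: subincl_surj => b; rewrite -[X in annU X]/(r * basis_elt R b0 b) /=.
    case: asboolP => _; first by rewrite mulr1; exact: (subinclP l).
    by rewrite mulr0; have /submoduleP[] := annU_submod.
  have -> : F b0 l = fN n.
    by apply: ci; rewrite fNE /= -[submod_val n]/(subincl subN n) nE linearZ_LR
      YE yF.
  have -> : x = xN n.
    apply: inX_inj; rewrite xNE xE /= -[submod_val n]/(subincl subN n) nE.
    by rewrite linearZ_LR theta'E.
  rewrite -gE /g0 /w -linearZ_LR -linearB; congr (g _).
  rewrite -[RHS]/(r *: 0 - - xN n, r *: basis_elt R b0 - subincl subN n).
  by rewrite nE scaler0 sub0r opprK subrr.
(* If [b0] is good, [extend] makes [f] multiplication by [w - c0]; if not, [F b0] is zero and
   [extend] makes [b0] good with constant [w]. *)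
have [[c0 c0E]|ngood] := pselect (good b0).
  apply: nf; exists (w - c0) => l; have [j Lj] := subinclP l.
  have [x xE xv] := valueE _ _ Lj.
  have := extend l x xE; rewrite -xv c0E // /F; case: asboolP => [_ E1|[]];
    last by exists c0.
  by rewrite scalerBr [X in _ - X]E1 opprB addrC subrK.
apply: (ngood); exists w => r j Lr; have [x xE ->] := valueE _ _ Lr.
have [l lE] := @subincl_surj _ _ _ annU_submod r (ex_intro _ j Lr).
rewrite (extend l) lE //; rewrite /F; case: asboolP => [/ngood//|_].
exact: subr0.
Qed.

End Branches.
(** [R / L] is cogenerated by [C], hence by [E], and 1 is not in [L] because each [J i] kills a
    nonzero element. A map to [E] that is nonzero at 1 gives the element sought, as every [J i] lies
    in [L]. *)
Lemma chain_kills : separated E C ->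
  (forall i, exists2 e : E, e <> 0 & kills (J i) e) ->
  exists2 e : E, e <> 0 & kills (\bigcup_i J i) e.
Proof.
move=> sepC aliveJ; have [V [dec dec_surj]] := label_exists.
have : separated C (quotmod annU_submod).
  apply/(left_perp_separated _ cotC)/Ext1_zeroE/regular_quotient_ext.
  exact: diagonal_extension dec_surj.
move=> /(separated_trans sepC) sepL.
have [|phi phi1] := sepL (quot_map annU_submod 1).
  move=> /quot_map_eq0[j L1]; have [e e0 /L1] := aliveJ j.
  by rewrite scale1r.
exists (phi (quot_map annU_submod 1)) => // r [i _ Jr].
rewrite -!linearZ_LR -[_ *: _]/(r * 1) mulr1.
suff -> : quot_map annU_submod (r : R^o) = 0 by exact: linear0.
by apply/quot_map_eq0; exists i => e; exact.
Qed.

End Diagonal.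
End WellOrderedChains.

(** * Finite character *)

Section FiniteCharacter.
Variable R : comPzRingType.
Implicit Types C E M N P Q S W Z : lmodType R.

(** The available order gives each nonempty subset a unique least element. Sets of two or three
    elements yield totality, antisymmetry and transitivity; a least non-accessible element yields
    well-foundedness. *)
Lemma well_ordering (T : eqType) : exists lt : T -> T -> Prop,
  [/\ well_founded lt, forall i j k, lt i j -> lt j k -> lt i k &
      forall i j, [\/ i = j, lt i j | lt j i]].
Proof.
have [le wo] := wochoice.well_ordering_principle T.
have minE (A : {pred T}) x : x \in A -> exists2 z, z \in A & forall y,
  y \in A -> le z y.
  by move=> xA; have [|z [[zA zle] _]] := wo A; [exists x|exists z].
have le_total x y : le x y \/ le y x.
  have [|z] := minE [pred z in [:: x; y]] x; first by rewrite !inE eqxx.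
  rewrite !inE => /orP[]/eqP-> h; [left|right]; apply: h;
    by rewrite !inE eqxx ?orbT.
have le_anti x y : le x y -> le y x -> x = y.
  move=> xy yx; have le_refl u : le u u by case: (le_total u u).
  have [|z [_ zu]] := wo [pred z in [:: x; y]]; first by exists x;
    rewrite !inE eqxx.
  rewrite -(zu x); first apply: zu; split; rewrite ?inE ?eqxx ?orbT // => u.
    by rewrite !inE => /orP[]/eqP->.
  by rewrite !inE => /orP[]/eqP->.
exists (fun x y => x <> y /\ le x y); split.
- move=> x; apply: contrapT => nx.
  have [|z /asboolP nz zmin] := minE [pred y | `[< ~ Acc (fun x y => x <> y /\
    le x y) y >]] x.
    exact/asboolP.
  apply: nz; split=> y [yz le_yz]; apply: contrapT => ny; apply: yz.
  by apply: le_anti => //; apply: zmin; exact/asboolP.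
- move=> i j k [ij le_ij] [jk le_jk].
  have [|z] := minE [pred z in [:: i; j; k]] i; first by rewrite !inE eqxx.
  rewrite !inE => /or3P[]/eqP-> h.
  + have ik : le i k by apply: h; rewrite !inE eqxx !orbT.
    by split=> // E; apply: ij; apply: le_anti => //; rewrite E.
  + by case: ij; apply: le_anti => //; apply: h; rewrite !inE eqxx.
  + by case: jk; apply: le_anti => //; apply: h; rewrite !inE eqxx orbT.
- move=> i j; have [->|/eqP ij] := eqVneq i j; first by constructor.
  have [le_ij|le_ji] := le_total i j; first by constructor 2.
  by constructor 3; split=> // ji; exact: ij.
Qed.

Definition alive E (A : set R) := exists2 e : E, e <> 0 & kills A e.

Lemma aliveS E (A B : set R) : A `<=` B -> alive E B -> alive E A.
Proof. by move=> AB [e e0 Be]; exists e => // r /AB; exact: Be. Qed.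

Section CotiltingInjective.
Variables (C E : lmodType R).
Hypotheses (cotC : one_cotilting C) (sepE : separated C E) (sepC : separated E
  C).

(* Transfinite induction along a well-order of R, adjoining to a finite set the
   elements of J one at a time; limit steps are instances of [chain_kills]. *)
Lemma alive_finite_character (J : set R) :
  (forall s : seq R, [set` s] `<=` J -> alive E [set` s]) -> alive E J.
Proof.
move=> alive_fin; have [lt [lt_wf lt_trans lt_total]] := well_ordering R.
(* [s] stays arbitrary so that the greatest element of [P], when there is one, can be moved into
   it. *)
pose claim (P : set R) := forall s : seq R,
  [set` s] `<=` J -> alive E ([set` s] `|` (J `&` P)).
pose down a := [set b | lt b a].
have step (P : set R) : (forall a b, lt a b -> P b -> P a) ->
    (forall a, P a -> claim (down a)) -> claim P.
  move=> downP claimP s sJ.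
  have [[x Px]|P0] := pselect (exists x, P x); last first.
    apply: aliveS (alive_fin s sJ) => r [//|[_ Pr]].
    by case: P0; exists r.
  have [[m [Pm mmax]]|nomax] := pselect (exists m, P m /\ forall y : R,
    P y -> ~ lt m y).
    have splitP r : P r -> r = m \/ lt r m.
      by move=> Pr; case: (lt_total r m) => [|?|/(mmax _ Pr)//]; [left|right].
    have [Jm|nJm] := pselect (J m).
      apply: aliveS (claimP m Pm (m :: s) _) => [r [rs|[Jr Pr]]|r /=].
      - by left => /=; rewrite inE [r \in s]rs orbT.
      - have [->|rm] := splitP _ Pr; first by left; rewrite /= inE eqxx.
        by right.
      - by rewrite inE => /predU1P[->//|]; exact: sJ.
    apply: aliveS (claimP m Pm s sJ) => r [rs|[Jr Pr]]; first by left.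
    by right; split=> //; have [rm|//] := splitP _ Pr; rewrite rm in Jr.
  (* Without a greatest element, each member of [P] lies strictly below another, so the sets [JI i]
     increase to all of [s] together with [J] in [P]. *)
  pose I := {x | P x}; pose ltI (i j : I) := lt (sval i) (sval j).
  pose JI (i : I) := [set` s] `|` (J `&` down (sval i)).
  have ltI_wf : well_founded ltI.
    suff H y : Acc lt y -> forall i : I, sval i = y -> Acc ltI i.
      by move=> i; exact: H (lt_wf _) i erefl.
    elim=> {}y _ IH i iy; split=> k; rewrite /ltI iy => ky.
    exact: IH ky k erefl.
  have ltI_total i j : [\/ i = j, ltI i j | ltI j i].
    have [ij|ij|ij] := lt_total (sval i) (sval j);
      [constructor 1|by constructor 2|by constructor 3].
    by apply: eq_sig_hprop ij => y p q; exact: Prop_irrelevance.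
  have ltI_nomax i : exists j, ltI i j.
    apply: contrapT => /forallNP noj; apply: nomax; exists (sval i).
    by split=> [|y Py]; [exact: svalP|exact: noj (exist _ y Py)].
  have JI_mono i j : ltI i j -> JI i `<=` JI j.
    by move=> ij r [rs|[Jr ri]]; [left|right; split=> //; exact: lt_trans ij].
  have ltI_trans i j k : ltI i j -> ltI j k -> ltI i k by exact: lt_trans.
  have aliveI i : alive E (JI i) by exact: (claimP _ (svalP i) s sJ).
  have := chain_kills cotC sepE ltI_wf ltI_trans ltI_total ltI_nomax
    (exist _ x Px) JI_mono sepC aliveI.
  apply: aliveS => r [rs|[Jr Pr]]; first by exists (exist _ x Px) => //; left.
  have [j rj] := ltI_nomax (exist _ r Pr).
  by exists j => //; right; split.
have claim_down a : claim (down a).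
  elim/(well_founded_ind lt_wf): a => a IH; apply: step => [b c bc ca|//].
  exact: lt_trans bc ca.
have claimT : claim setT by apply: step => // a _; exact: claim_down.
have /claimT : [set` [::] : seq R] `<=` J by [].
by apply: aliveS => r Jr; right.
Qed.

End CotiltingInjective.

(** * Finitely presented test modules attached to finite sets of scalars *)

Section FiniteIdealModule.
Variable s : seq R.

Fact row_scale_linear :
  linear (fun v : 'rV[R]_1 => \row_(k < size s) (v 0 0 * s`_k)).
Proof. by move=> a u v; apply/rowP => k; rewrite !mxE mulrDl mulrA. Qed.

Definition row_scale : {linear 'rV[R]_1 -> 'rV[R]_(size s)} := Lin
  row_scale_linear.

(* Its first syzygy is the row of the elements of s, so that Tor_1(M, -) is the
   annihilator of s in M. *)
Definition coker_row : lmodType R := quotmod (range_submod row_scale).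

Lemma row_scale_exact :
  exact_at row_scale (quot_map (range_submod row_scale)).
Proof.
apply/exactP => y; split=> [/quot_map_eq0[x _ <-]|[x <-]]; first by exists x.
by apply/quot_map_eq0; exists x.
Qed.

Lemma coker_row_fp : finitely_presented coker_row.
Proof.
exists 1%N, (size s), row_scale, (quot_map (range_submod row_scale)).
by split; [exact: row_scale_exact|apply/surjP; exact: quot_map_surj].
Qed.

Hypothesis faithful : forall r : R, kills (E := R^o) [set` s] r -> r = 0.

Lemma row_scale_res :
  short_exact row_scale (quot_map (range_submod row_scale)).
Proof.
split; [|exact: row_scale_exact|by apply/surjP; exact: quot_map_surj].
apply: lin_inj => v v0; apply/rowP => k; rewrite ord1 mxE.
apply: faithful => r /(nthP 0)[i si <-].
have /rowP/(_ (Ordinal si)) := v0; rewrite !mxE /= => vs.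
by rewrite -[LHS]/(s`_i * v 0 0) mulrC.
Qed.

Lemma coker_row_pd : projdim_le1 coker_row.
Proof.
exists 'rV[R]_1, 'rV[R]_(size s), row_scale,
  (quot_map (range_submod row_scale)).
split; [exact: rV_projective|exact: rV_projective|exact: row_scale_res].
Qed.

Lemma Tor1_zero_coker_row M :
  Tor1_zero M coker_row <-> forall x : M, kills [set` s] x -> x = 0.
Proof.
have torP := Tor1_zero_two_term (@rV_projective R 1) (@rV_projective R (size s))
  row_scale_res M.
pose id1 : {linear 'rV[R]_1 -> 'rV[R]_1} := idfun.
have id1K : cancel id1 id1 by [].
have sysP := tensor_map_inj_system M row_scale id1K.
have dE (k : 'I_1) l : row_scale (delta_mx 0 k) 0 l = s`_l.
  by rewrite !mxE ord1 !eqxx mul1r.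
split=> [/torP/sysP sol x xs|ann].
  apply: (sol (fun=> x) _ ord0) => w [[l wE]|[j wE]]; rewrite big_ord1 wE.
    by rewrite /= dE; apply: xs; exact: mem_nth.
  by rewrite /= !mxE !ord1 !eqxx subrr scale0r.
apply/torP/sysP => x xsol k; apply: ann => r /(nthP 0)[i si <-].
rewrite -[RHS](xsol (fun=> s`_i)) ?big_ord1 ?ord1 //.
by left; exists (Ordinal si) => h; rewrite dE.
Qed.

End FiniteIdealModule.

Lemma projective_ext_lift P C : projective_module P -> ext_lift P C.
Proof.
move=> projP; apply: (@ext_lift_cover _ _ _ 'rV[R]_0 P \0 idfun projP).
- apply/exactP => y; split=> [/= ->|[x <-] //]; by exists 0.
- by apply/surjP => y; exists y.
- by move=> f _; exists \0 => y; rewrite [y](_ : _ = 0) ?linear0 //;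
    apply/rowP; case.
Qed.

Lemma closed_envelopes_cofinite_type (K : lmodType R -> Prop) :
  one_cotilting_class K -> closed_injective_envelopes K -> cofinite_type K.
Proof.
move=> [C cotC KC] closedK; have [E envE] := cotilting_envelope cotC.
have KsepC M : K M <-> separated C M.
  by split=> [/KC/(left_perp_separated _ cotC)|/(left_perp_separated _
    cotC)/KC].
have sepE : separated C E.
  by apply/KsepC; apply: closedK envE; apply/KsepC; exact: separated_refl.
have sepC : separated E C by apply: separated_env envE _; exact: separated_refl.
have KsepE M : K M <-> separated E M.
  split=> [/KsepC|sepM]; first exact: separated_trans sepC.
  by apply/KsepC; exact: separated_trans sepM.
(* [R] is projective, so it lies in [K]. Hence a finite set killing no nonzero element of [E] kills
   none of [R], and its test module has projective dimension at most 1. *)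
have sepR : separated E R^o.
  apply/KsepE/KC/Ext1_zeroE; apply: projective_ext_lift.
  exact: regular_projective.
have faithful M (A : set R) (x : M) :
    separated E M -> ~ alive E A -> kills A x -> x = 0.
  move=> sepM nA Ax; apply: contrapT => /sepM[phi phix]; apply: nA.
  by exists (phi x) => // r /Ax rx; rewrite -linearZ_LR rx linear0.
exists {s : seq R | ~ alive E [set` s]}, (fun s => coker_row (sval s)).
have faithR (s : {s : seq R | ~ alive E [set` s]}) (r : R) :
    kills (E := R^o) [set` sval s] r -> r = 0.
  exact: (faithful R^o _ r sepR (svalP s)).
split=> [s|M].
  by split; [exact: coker_row_fp|exact: coker_row_pd (faithR s)].
split=> [/KsepE sepM s|tor].
  by apply/(Tor1_zero_coker_row (faithR s)) => x; exact: faithful (svalP s).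
apply/KsepE => x x0.
(* A finite subset of the annihilator of [x] that is not alive would, through Tor, force [x = 0];
   finite character then handles the whole annihilator. *)
have [e e0 ex] : alive E [set r : R | r *: x = 0].
  apply: (alive_finite_character cotC sepE sepC) => s sx.
  apply: contrapT => ns; apply: x0.
  have /(Tor1_zero_coker_row (faithR (exist _ s ns))) := tor (exist _ s ns).
  by apply=> r /sx.
(* As the annihilator of [x] kills [e], sending [x] to [e] is well defined on [R x] and extends to
   [M] by injectivity of [E]. *)
have [r rx|phi phiE] := @inj_ext _ E _ _ (elt x) (elt e) (proj1 envE).
  exact: ex.
exists phi; have := phiE 1; rewrite /= !scale1r => ->; exact: e0.
Qed.

End FiniteCharacter.

Theorem corollary3p13 (R : comPzRingType) (K : lmodType R -> Prop)
    (HK : one_cotilting_class K) :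
  (cofinite_type K <-> closed_injective_envelopes K) /\
  (closed_injective_envelopes K <->
   (forall C : lmodType R,
      one_cotilting C -> (forall M : lmodType R, K M <-> left_perp C M) ->
      forall E : lmodType R, injective_envelope C E -> Prod C E)).
Proof.
split; last exact: closed_envelopes_Prod.
split; first exact: cofinite_type_closed_envelopes.
exact: closed_envelopes_cofinite_type.
Qed.
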